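(* Let $s\in(0,1)$, let $B_1$ be the open unit ball of $\mathbb{R}^n$ centered at the origin, let $x_0\in\partial B_1$ and let $k\geqslant2$ be an even integer. There exist $\varrho\in(0,1)$ and a compactly supported function $u\in C(\mathbb{R}^n)\cap C^\infty(B_1)$ such that $u(x_0)=0$, with $$(-\Delta)^su=0\quad\text{in }B_1,$$ $$u>0\quad\text{in }B_\varrho(x_0)\setminus\{x_0\},$$ and $$\limsup_{x\to x_0}\frac{u(x)}{|x-x_0|^k}=1.$$ In particular, for this $u$ the following claim does not hold: for every $\beta\in(0,\pi/2)$, $$\liminf_{B_1\ni x\to x_0}\frac{u(x)}{|x-x_0|^s}>0,$$ where the $\liminf$ is taken over those $x\in B_1$ such that the angle between $x-x_0$ and the inner normal direction $-x_0$ is smaller than $\pi/2-\beta$.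
   Context: $(-\Delta)^s$ is the fractional Laplacian, i.e. up to a positive normalization constant $(-\Delta)^sw(x)=PV\int_{\mathbb{R}^n}\frac{w(x)-w(x+y)}{|y|^{n+2s}}\,dy$, with $PV$ the principal value. *)

(* Defs.v *)
From HB Require Import structures.
From mathcomp Require Import all_boot all_order all_algebra.
From mathcomp Require Import all_classical all_reals all_analysis.

Set Implicit Arguments.
Unset Strict Implicit.
Unset Printing Implicit Defensive.

Import Order.TTheory GRing.Theory Num.Theory.
Import numFieldNormedType.Exports.

Local Open Scope classical_set_scope.
Local Open Scope ring_scope.

(* The norm `|x| that MathComp-Analysis puts on 'rV[R]_n is the sup norm; it
   gives the usual topology, but balls, angles and |y|^(n+2s) are Euclidean. *)
Definition dot (R : realType) (n : nat) (x y : 'rV[R]_n) : R :=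
  \sum_(i < n) x 0 i * y 0 i.

Definition enorm (R : realType) (n : nat) (x : 'rV[R]_n) : R :=
  Num.sqrt (dot x x).

Definition eball (R : realType) (n : nat) (x : 'rV[R]_n) (r : R) :
    set 'rV[R]_n :=
  [set y | enorm (y - x) < r].

Definition angle (R : realType) (n : nat) (x y : 'rV[R]_n) : R :=
  acos (dot x y / (enorm x * enorm y)).

(* The points seen from x0 at an angle smaller than pi/2 - beta with -x0, the
   inner normal to the unit ball at x0. *)
Definition inner_cone (R : realType) (n : nat) (x0 : 'rV[R]_n) (beta : R) :
    set 'rV[R]_n :=
  [set x | angle (x - x0) (- x0) < pi / 2 - beta].

Section lebesgue_cons.
Context (R : realType) (n : nat).
Variable mu : {sigma_finite_measure set (n.-tuple (measurableTypeR R)) -> \bar R}.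
Local Open Scope ereal_scope.

Definition tcons (p : measurableTypeR R * n.-tuple (measurableTypeR R)) :
  n.+1.-tuple (measurableTypeR R) := [tuple of p.1 :: p.2].

Lemma measurable_tcons : measurable_fun setT tcons.
Proof. exact: measurable_cons. Qed.

Definition lebesgue_cons : set (n.+1.-tuple (measurableTypeR R)) -> \bar R :=
  pushforward (@lebesgue_measure R \x mu) tcons.

#[local] Hint Resolve measurable_tcons : core.

Let lebesgue_cons0 : lebesgue_cons set0 = 0.
Proof. exact: measure0. Qed.

Let lebesgue_cons_ge0 A : 0 <= lebesgue_cons A.
Proof. exact: measure_ge0. Qed.

Let lebesgue_cons_sigma_additive : semi_sigma_additive lebesgue_cons.
Proof. exact: measure_semi_sigma_additive. Qed.

HB.instance Definition _ := isMeasure.Build _ _ _ lebesgue_cons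
  lebesgue_cons0 lebesgue_cons_ge0 lebesgue_cons_sigma_additive.

Let lebesgue_cons_sigma_finite : sigma_finite setT lebesgue_cons.
Proof.
have /sigma_finiteP[F [TF ndF Foo]] := sigma_finiteT (@lebesgue_measure R).
have /sigma_finiteP[G [TG ndG Goo]] := sigma_finiteT mu.
exists (fun i => [set t | F i (thead t) /\ G i [tuple of behead t]]) => [|i].
  apply/seteqP; split=> // t _.
  have [i _ Fi] : (\bigcup_i F i) (thead t) by rewrite -TF.
  have [j _ Gj] : (\bigcup_i G i) [tuple of behead t] by rewrite -TG.
  exists (maxn i j) => //; split.
    by move: Fi; exact/subsetPset/ndF/leq_maxl.
  by move: Gj; exact/subsetPset/ndG/leq_maxr.
have [mF Fi] := Foo i; have [mG Gi] := Goo i; split.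
  apply: measurableI; rewrite -[X in measurable X]setTI.
    exact: (@measurable_tnth _ _ _ ord0).
  exact: measurable_behead.
rewrite /lebesgue_cons /pushforward.
rewrite (_ : _ @^-1` _ = F i `*` G i); last first.
  apply/seteqP; split=> -[x t] /= [Fx Gt]; split => //.
    by move: Gt; congr (G i _); exact/val_inj.
  by move: Gt; congr (G i _); exact/val_inj.
by rewrite product_measure1E// lte_mul_pinfty// ge0_fin_numE.
Qed.

HB.instance Definition _ := Measure_isSigmaFinite.Build _ _ _ lebesgue_cons
  lebesgue_cons_sigma_finite.

End lebesgue_cons.

Fixpoint lebesgue_tuple (R : realType) (n : nat) :
    {sigma_finite_measure set (n.-tuple (measurableTypeR R)) -> \bar R} :=
  if n is n'.+1 then lebesgue_cons (lebesgue_tuple R n') else dirac [tuple].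

Lemma lebesgue_tuple_box (R : realType) (n : nat)
    (A : 'I_n -> set (measurableTypeR R)) :
  (forall i, measurable (A i)) ->
  lebesgue_tuple R n [set t | forall i, A i (tnth t i)] =
  (\prod_(i < n) lebesgue_measure (A i))%E.
Proof.
elim: n A => [|n IH] A mA.
  by rewrite big_ord0 /= diracE mem_set// => -[].
rewrite big_ord_recl /= /lebesgue_cons /pushforward.
rewrite -IH; last by move=> i; exact: mA.
rewrite -product_measure1E//; last first.
  rewrite (_ : [set _ | _] = \bigcap_(i in [set: 'I_n])
     ((fun t : n.-tuple (measurableTypeR R) => tnth t i) @^-1` A (lift ord0 i))).
    apply: fin_bigcap_measurable => // i _.
    by rewrite -[X in measurable X]setTI; apply: measurable_tnth => //; exact: mA.
  by apply/seteqP; split=> [t At i _|t At i]; exact: At.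
congr (_ _); apply/seteqP; split=> [[x t] /= At|[x t] /= [Ax At] i].
  split=> [|i]; first exact: (At ord0).
  by have := At (lift ord0 i); rewrite tnthS.
by have [j ->|->//] := unliftP ord0 i; rewrite tnthS; exact: At.
Qed.

Definition rV_of_tuple (R : realType) (n : nat)
    (t : n.-tuple (measurableTypeR R)) : 'rV[R]_n :=
  \row_(i < n) tnth t i.

Section frac_laplacian.
Context (R : realType) (n : nat).
Implicit Types (s : R) (w : 'rV[R]_n -> R) (x y : 'rV[R]_n).

Definition frac_laplacian_kernel s w x y : R :=
  (w x - w (x + y)) / (enorm y `^ (n%:R + 2 * s)).

(* (-Delta)^s w (x) = l without the positive normalization constant: the
   integral over |y| >= e converges for every e > 0, and tends to l as
   e -> 0+. *)
Definition is_frac_laplacian s w x (l : R) : Prop :=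
  let D (e : R) := [set t | e <= enorm (rV_of_tuple t)] in
  let K t := (frac_laplacian_kernel s w x (rV_of_tuple t))%:E in
  (forall e : R, 0 < e -> (lebesgue_tuple R n).-integrable (D e) K) /\
  (\int[lebesgue_tuple R n]_(t in D e) K t)%E @[e --> 0^'+] --> l%:E.

Definition iter_partial (js : seq 'I_n) w : 'rV[R]_n -> R :=
  foldr (fun j g x => 'D_(delta_mx 0 j) g x) w js.

(* For open U: partial derivatives of every order exist and are continuous
   in U. *)
Definition smooth_on (U : set 'rV[R]_n) w : Prop :=
  forall (js : seq 'I_n) x, U x ->
    {for x, continuous (iter_partial js w)} /\
    forall j : 'I_n, derivable (iter_partial js w) x (delta_mx 0 j).

Definition compactly_supported w : Prop :=
  compact (closure [set x | w x != 0]).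

End frac_laplacian.

(* Main.v *)
Require Import Defs.
From mathcomp Require Import all_boot all_order all_algebra.
From mathcomp Require Import all_classical all_reals all_analysis.
From mathcomp Require Import measurable_realfun ring lra zify.

(* For k = 2 m the solution is a combination
     u(x) = sum_i c_i (A_i - |x - x0|^2)_+^s,   A_i = 5 * 2^i,
   of torsion functions of balls that contain the closure of B_1.  The
   fractional Laplacian of (A - |x - x0|^2)_+^s inside its ball is a constant
   that does not depend on A, so u is s-harmonic in B_1 as soon as
   sum_i c_i = 0.  Moreover u is a function of t = |x - x0|^2, and its first m
   derivatives at t = 0 vanish if and only if the polynomial sum_i c_i X^i
   vanishes at 2^s, 2^(s-1), ..., 2^(s-m+1).  Taking
   (X - 1) prod_(j < m) (X - 2^(s-j)) thus gives u(x) / |x - x0|^k --> L with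
   L != 0, and dividing by L makes the limit 1.

   That the fractional Laplacian is constant is checked on lines through x.
   On a line A - |x - x0|^2 becomes q(r) = a + 2 b r - c r^2, and
   y = q / r^2 satisfies
     y_+^s / r = - psi(y) y' / 2 + b psi(y) / r^2,   psi(y) = y_+^s / (c + y_+),
   which has an explicit antiderivative; adding the contributions of b and -b,
   the integral of q_+^s / |r|^(1+2s) over |r| >= 1/T is, up to O(T^(2s-2)), the
   divergent term a^s T^(2s) / s minus a quantity that is independent of a.
   Passing from lines to R^n uses polar coordinates in the form
     ln 2 * int f = int_{1 <= |z| <= 2} int_{r > 0} f(r z) r^(n-1) dr dz,
   which follows from Tonelli's theorem and the scaling of Lebesgue measure
   alone. *)

Set Implicit Arguments.
Unset Strict Implicit.
Unset Printing Implicit Defensive.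

Import Order.TTheory GRing.Theory Num.Theory.
Import numFieldNormedType.Exports.

Local Open Scope classical_set_scope.
Local Open Scope ring_scope.

(** * Powers of the positive part *)

(* The truncation is needed because x `^ s = 1 for x < 0. *)
Definition pospow (R : realType) (s t : R) : R := Num.max t 0 `^ s.

Section pospow.
Context (R : realType).
Implicit Types s t a b c x y z r : R.

Lemma pospowE s t : 0 <= t -> pospow s t = t `^ s.
Proof. by move=> t0; rewrite /pospow max_l. Qed.

Lemma pospow_le0 s t : 0 < s -> t <= 0 -> pospow s t = 0.
Proof. by move=> s0 t0; rewrite /pospow max_r// powR0// gt_eqF. Qed.

Lemma pospow_ge0 s t : 0 <= pospow s t.
Proof. exact: powR_ge0. Qed.

Lemma pospowMl s t a : 0 < s -> 0 < a -> pospow s (t * a) = pospow s t * a `^ s.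
Proof.
move=> s0 a0; have [t0|t0] := leP 0 t.
  by rewrite !pospowE ?mulr_ge0// ?powRM// ltW.
by rewrite !pospow_le0 ?mul0r// ?mulr_le0_ge0// ltW.
Qed.

Lemma pospow_continuous s : 0 < s -> continuous (pospow s).
Proof.
move=> s0 t; have [t0|t0|->] := ltgtP t 0.
- have tn : nbhs t [set x | x < 0] by exact: lt_nbhsl.
  rewrite /continuous_at pospow_le0 ?ltW//.
  apply: cvg_near_cst.
  by near=> x; rewrite pospow_le0// ltW//; near: x.
- have tn : nbhs t [set x | 0 < x] by exact: lt_nbhsr.
  rewrite /continuous_at pospowE ?ltW//.
  apply: (@cvg_trans _ ((fun x : R => x `^ s) x @[x --> t])).
    apply: near_eq_cvg; near=> x; rewrite pospowE// ltW//; near: x.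
    exact: tn.
  have : {for t, continuous (fun x : R => x `^ s)}; last exact.
  apply/differentiable_continuous/derivable1_diffP.
  by apply: derivable_powR; rewrite in_itv/= t0.
- rewrite /continuous_at pospow_le0//.
  apply/cvgrPdist_lt => /= e e0.
  (* The radius [e^(1/s)] is the preimage of [e] under [x -> x^s]. *)
  have d0 : 0 < e `^ s^-1 by exact: powR_gt0.
  near=> x; rewrite sub0r normrN ger0_norm ?pospow_ge0//.
  have [x0|x0] := leP x 0; first by rewrite pospow_le0.
  rewrite pospowE ?ltW//.
  have -> : e = (e `^ s^-1) `^ s.
    by rewrite -powRrM mulVf ?gt_eqF// powRr1// ltW.
  apply: gt0_ltr_powR => //; rewrite ?nnegrE ?ltW//.
  rewrite -(gtr0_norm x0); near: x; exact: (@pseudometric_normed_Zmodule.nbhs0_lt _ R^o _ d0).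
Unshelve. all: by end_near. Qed.

End pospow.

(** The primitive is the integral from [p - 1]. The base point lies strictly below [p], so the
    fundamental theorem of calculus covers every [x > p - 1], in particular [p] itself; further to
    the left the primitive is locally 0, as is [f]. *)
Lemma primitive_exists (R : realType) (f : R -> R) (p : R) :
  continuous f -> (forall x, x <= p -> f x = 0) ->
  exists F : R -> R, (forall x : R, is_derive x 1 F (f x)) /\
    (forall x, x <= p -> F x = 0).
Proof.
move=> cf f0.
pose F x := (\int[lebesgue_measure]_(t in `[p - 1, x]) f t)%R.
have F0 x : x <= p -> F x = 0.
  move=> xp; rewrite /F; under eq_Rintegral.
    move=> t; rewrite inE/= in_itv/= => /andP[_ tx].
    rewrite f0; last exact: le_trans xp.
    over.
  by rewrite Rintegral_cst//= mul0r.
exists F; split => // x; have [xp|xp] := ltP (p - 1) x.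
  have [||df Ff] := @continuous_FTC1_closed _ f (p - 1) x (x + 1) _ _ xp (cf x).
  - by rewrite ltrDl.
  - apply: continuous_compact_integrable; first exact: segment_compact.
    exact: continuous_subspaceT.
  by apply: DeriveDef; [exact: df|rewrite -Ff derive1E].
have xp' : x < p by lra.
rewrite f0 ?ltW//.
apply: (@near_eq_is_derive _ _ _ (cst 0)) => //.
  near=> y; rewrite /cst/= F0// ltW//; near: y.
  exact: lt_nbhsl.
Unshelve. all: by end_near. Qed.

(** * Integrals along a line *)

(** This is psi. Truncating the denominator as well keeps it at least [c], so psi is continuous on
    the whole line when [s] and [c] are positive. *)
Definition pospow_ratio (R : realType) (s c y : R) : R :=
  pospow s y / (c + Num.max y 0).

Section line_primitive.
Context (R : realType) (s : R).
Hypothesis s0 : 0 < s.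
Implicit Types a b c x y r : R.

Lemma pospow_ratio_continuous c : 0 < c -> continuous (pospow_ratio s c).
Proof.
move=> c0 y; apply: cvgM; first exact: pospow_continuous.
apply: cvgV.
  by rewrite gt_eqF// ltr_pwDl// le_max lexx orbT.
apply: cvgD; first exact: cvg_cst.
exact: (continuous_max cvg_id (cvg_cst _)).
Qed.

Lemma pospow_ratio_le0 c y : y <= 0 -> pospow_ratio s c y = 0.
Proof. by move=> y0; rewrite /pospow_ratio pospow_le0// mul0r. Qed.

Lemma pospow_ratioMD c y : 0 < c -> pospow_ratio s c y * (y + c) = pospow s y.
Proof.
move=> c0; have [y0|y0] := leP 0 y.
  rewrite /pospow_ratio max_l// (addrC y) divfK// gt_eqF//; lra.
by rewrite pospow_ratio_le0 ?pospow_le0 ?mul0r// ltW.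
Qed.

Lemma pospow_ratio_bound c y : 0 < c -> 0 < y ->
  0 <= pospow_ratio s c y <= y `^ (s - 1).
Proof.
move=> c0 y0; rewrite /pospow_ratio max_l ?(ltW y0)// pospowE ?(ltW y0)//.
apply/andP; split; first by rewrite divr_ge0 ?powR_ge0//; lra.
rewrite -(mulr_powRB1 (ltW y0) s0) mulrAC ler_piMl ?powR_ge0//.
by rewrite ler_pdivrMr; lra.
Qed.

(** The quotient y = q / r^2 with q = a + 2 b r - c r^2. *)
Definition line_ratio a b c r := a * r^-1 ^+ 2 + 2 * b * r^-1 - c.

(** [Psi] stands for a primitive of psi. Completing the square gives y = a x^2 - (c + b^2 / a) with
    x = 1/r + b/a, and [N] stands for a primitive of psi(y) in the variable x. The two terms
    integrate - psi(y) y' / 2 and b psi(y) / r^2. *)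
Definition line_antiderivative (Psi N : R -> R) a b c r :=
  - (2^-1 * Psi (line_ratio a b c r) + b * N (r^-1 + b / a)).

Lemma is_derive_line_ratio a b c r : r != 0 ->
  is_derive r 1 (line_ratio a b c)
    (- 2 * (a * r^-1 ^+ 3 + b * r^-1 ^+ 2)).
Proof.
move=> r0; rewrite /line_ratio.
have V := is_deriveV r0 (is_derive_id r (1 : R)).
apply: is_derive_eq; rewrite /GRing.scale/= !exprS expr0 !mulr1.
by field.
Qed.

(* Cutting x at 0 in the argument makes the integrand vanish for x <= 0, so that
   it has an antiderivative that is 0 near 0; the values actually used satisfy
   r^-1 + b / a >= - |b| / a, where both versions agree. *)
Lemma line_primitive_shift a b c (N : R -> R) : 0 < a -> 0 < c ->
  (forall x, is_derive x (1 : R) N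
     (pospow_ratio s c (a * (Num.max x 0) ^+ 2 - (c + b ^+ 2 / a)))) ->
  forall r, 0 < r ->
  is_derive r (1 : R) (fun r => N (r^-1 + b / a))
     (- pospow_ratio s c (line_ratio a b c r) * r^-1 ^+ 2).
Proof.
move=> a0 c0 dN r r0.
have V := is_deriveV (lt0r_neq0 r0) (is_derive_id r (1 : R)).
have dI : is_derive r (1 : R) (fun r => r^-1 + b / a) (- r^-1 ^+ 2).
  apply: is_derive_eq; rewrite /GRing.scale/= mulr1 addr0.
  by rewrite exprVn.
have := is_derive1_comp (dN _) dI; rewrite /comp => H.
apply: (is_derive_eq H); rewrite mulrN mulNr; congr (- (_ * _)).
have yE : line_ratio a b c r = a * (r^-1 + b / a) ^+ 2 - (c + b ^+ 2 / a).
  by rewrite /line_ratio; field; rewrite !gt_eqF.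
have [x0|x0] := leP 0 (r^-1 + b / a).
  by rewrite yE.
rewrite !pospow_ratio_le0//.
  have r'0 : 0 < r^-1 by rewrite invr_gt0.
  have : (r^-1 + b / a) ^+ 2 <= (b / a) ^+ 2 by nra.
  rewrite yE -(ler_pM2l a0) => h.
  have -> : b ^+ 2 / a = a * (b / a) ^+ 2 by field; rewrite gt_eqF.
  by lra.
rewrite expr0n/= mulr0 sub0r oppr_le0.
by rewrite addr_ge0 ?(ltW c0)// divr_ge0 ?sqr_ge0 ?(ltW a0).
Qed.

Lemma is_derive_line_antiderivative a b c (Psi N : R -> R) : 0 < a -> 0 < c ->
  (forall x, is_derive x (1 : R) Psi (pospow_ratio s c x)) ->
  (forall x, is_derive x (1 : R) N
     (pospow_ratio s c (a * (Num.max x 0) ^+ 2 - (c + b ^+ 2 / a)))) ->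
  forall r, 0 < r ->
  is_derive r (1 : R) (line_antiderivative Psi N a b c)
    (pospow s (a + 2 * b * r - c * r ^+ 2) / r `^ (1 + 2 * s)).
Proof.
move=> a0 c0 dPsi dN r r0.
have dN' := line_primitive_shift a0 c0 dN r0.
have dy := is_derive_line_ratio a b c (lt0r_neq0 r0).
have := is_derive1_comp (dPsi _) dy; rewrite /comp => dP'.
apply: is_derive_eq; rewrite /GRing.scale/=.
set y := line_ratio a b c r.
(* Since - y' / 2 + b / r^2 = a / r^3 + 2 b / r^2 = (y + c) / r, the denominator of psi cancels and
   y_+^s / r remains. *)
transitivity (pospow_ratio s c y * (y + c) / r).
  by rewrite /y /line_ratio; field; rewrite gt_eqF.
rewrite pospow_ratioMD//.
have -> : a + 2 * b * r - c * r ^+ 2 = y * r ^+ 2.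
  by rewrite /y /line_ratio; field; rewrite gt_eqF.
rewrite pospowMl ?exprn_gt0//.
rewrite powRD ?(gt_eqF r0) ?implybT// powRr1 ?ltW// powRrM.
rewrite -(powR_mulrn 2 (ltW r0)) invfM (mulrC r^-1) mulrA mulfK//.
by rewrite gt_eqF// powR_gt0// powR_gt0.
Qed.

End line_primitive.

(** * Bernoulli inequalities for real exponents and a mean value estimate *)

Lemma powR_bernoulli_le (R : realType) (s z : R) : 0 < s -> s < 1 -> -1 <= z ->
  (1 + z) `^ s <= 1 + s * z.
Proof.
move=> s0 s1 z1.
have z0 : 0 <= 1 + z by lra.
(* Young's inequality for (1 + z)^s and 1, with conjugate exponents 1/s and 1/(1 - s). *)
have := @conjugate_powR R ((1 + z) `^ s) 1 s^-1 (1 - s)^-1 (powR_ge0 _ _) ler01.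
rewrite !invr_gt0 !invrK subr_gt0 => /(_ s0 s1 (subrKC _ _)).
rewrite -powRrM mulfV ?gt_eqF// powRr1// powR1 mulr1; lra.
Qed.

(** Write (1 + z)^s = (1 + z) / (1 + z)^(1 - s) and bound the denominator from above by the other
    Bernoulli inequality. What remains is z^2 (1 - s (1 - s) + (1 - s) z) >= 0. *)
Lemma powR_bernoulli_ge (R : realType) (s z : R) : 0 < s -> s < 1 ->
  `|z| <= 2^-1 -> 1 + s * z - z ^+ 2 <= (1 + z) `^ s.
Proof.
move=> s0 s1; rewrite ler_norml => /andP[z1 z2].
have z0 : 0 < 1 + z by lra.
have d0 : 0 < (1 + z) `^ (1 - s) by exact: powR_gt0.
have : (1 + z) `^ (1 - s) <= 1 + (1 - s) * z.
  by apply: powR_bernoulli_le; lra.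
set d := (1 + z) `^ (1 - s) in d0 *; move=> dle.
have -> : (1 + z) `^ s = (1 + z) / d.
  apply: (@mulIf _ d); first by rewrite gt_eqF.
  rewrite divfK ?gt_eqF// /d -powRD ?(gt_eqF z0) ?implybT//.
  by rewrite (_ : s + (1 - s) = 1) ?powRr1 ?(ltW z0)//; ring.
have [n0|n0] := leP (1 + s * z - z ^+ 2) 0.
  by apply: (le_trans n0); rewrite divr_ge0// ltW.
rewrite ler_pdivlMr//.
apply: (@le_trans _ _ ((1 + s * z - z ^+ 2) * (1 + (1 - s) * z))).
  by rewrite ler_wpM2l// ltW.
have : 0 <= z ^+ 2 * (1 - s * (1 - s) + (1 - s) * z).
  by rewrite mulr_ge0 ?sqr_ge0//; nra.
by lra.
Qed.

Lemma mean_value_le (R : realType) (F f : R -> R) (lo hi M : R) :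
  (forall x, lo <= x <= hi -> is_derive x (1 : R) F (f x)) ->
  (forall x, lo <= x <= hi -> `|f x| <= M) ->
  forall x y, lo <= x <= hi -> lo <= y <= hi -> `|F y - F x| <= M * `|y - x|.
Proof.
move=> dF fM.
suff H x y : x <= y -> lo <= x <= hi -> lo <= y <= hi ->
    `|F y - F x| <= M * `|y - x|.
  move=> x y xI yI; have [xy|/ltW yx] := leP x y; first exact: H.
  by rewrite distrC (distrC y); exact: H.
move=> xy /andP[lx xh] /andP[ly yh].
have sub z : x <= z <= y -> lo <= z <= hi by move=> /andP[xz zy]; lra.
have [||z zI ->] := @MVT_segment R F f x y xy.
- by move=> z; rewrite in_itv/= => /andP[/ltW xz /ltW zy]; apply: dF; apply: sub; rewrite xz zy.
- apply: derivable_within_continuous => z; rewrite in_itv/= => zI.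
  by have [] := dF z (sub _ zI).
by rewrite normrM ler_wpM2r//; apply: fM; apply: sub; move: zI; rewrite in_itv.
Qed.

Lemma gt0_mulr_powRB1 (R : realType) (x p : R) : 0 < x ->
  x * x `^ (p - 1) = x `^ p.
Proof.
move=> x0; rewrite -[X in X * _](powRr1 (ltW x0)) -powRD ?subrKC//.
by rewrite (gt_eqF x0) implybT.
Qed.

(** * Behaviour of the line antiderivatives at r = 1/T for large T *)

Section line_asymptotic.
Context (R : realType) (s : R).

Lemma le_powR_neg (x y p : R) : 0 < x -> x <= y -> p <= 0 -> y `^ p <= x `^ p.
Proof.
move=> x0 xy p0; rewrite -[p]opprK !(powRN _ (- p)).
have y0 := lt_le_trans x0 xy.
rewrite lef_pV2 ?posrE ?powR_gt0//.
by apply: ge0_ler_powR; rewrite ?nnegrE ?oppr_ge0// ltW.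
Qed.

Lemma powR_half_le (x y p : R) (j : nat) : 0 < x -> x / 2 <= y -> - j%:R <= p <= 0 ->
  y `^ p <= 2 ^+ j * x `^ p.
Proof.
move=> x0 xy /andP[jp p0].
have h0 : 0 < x / 2 by lra.
apply: (le_trans (le_powR_neg h0 xy p0)).
rewrite powRM ?invr_ge0 ?(ltW x0)// mulrC ler_wpM2r ?powR_ge0//.
rewrite -[2^-1]powR_inv1// -powRrM mulN1r -powR_mulrn//.
by apply: ler_powR; lra.
Qed.

(** The derivative of y^s / s - Psi(y) is y^(s-1) - psi(y) = c y^(s-1) / (c + y) <= c y^(s-2), one
    power better than each term alone. The factor 16 is 4 from [c <= 4] times 2^2 from evaluating a
    power of exponent at least -2 at [lo / 2]. *)
Lemma potential_diff (c lo x y : R) (Psi : R -> R) :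
  0 < s -> s < 1 -> 0 < c <= 4 -> 0 < lo ->
  (forall x, is_derive x (1 : R) Psi (pospow_ratio s c x)) ->
  lo / 2 <= x -> lo / 2 <= y ->
  `|(y `^ s / s - Psi y) - (x `^ s / s - Psi x)|
    <= 16 * lo `^ (s - 2) * `|y - x|.
Proof.
move=> s0 s1 /andP[c0 c4] l0 dPsi lx ly.
have hl0 : 0 < lo / 2 by lra.
pose f z := z `^ (s - 1) - pospow_ratio s c z.
apply: (@mean_value_le _ (fun z => z `^ s / s - Psi z) f (lo / 2) (Num.max x y)).
- move=> z /andP[lz _]; have z0 := lt_le_trans hl0 lz.
  have dp := is_derive1_powR s z0.
  have dP := dPsi z.
  apply: is_derive_eq; rewrite /GRing.scale/= /f; congr (_ - _).
  by rewrite mulr0 add0r mulrA mulVf ?mul1r// gt_eqF.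
- move=> z /andP[lz _]; have z0 := lt_le_trans hl0 lz.
  have /andP[p1 p2] := pospow_ratio_bound s0 c0 z0.
  rewrite ger0_norm ?subr_ge0// /f /pospow_ratio max_l ?(ltW z0)//.
  rewrite pospowE ?(ltW z0)// -(mulr_powRB1 (ltW z0) s0).
  have -> : z `^ (s - 1) - z * z `^ (s - 1) / (c + z) =
     c * z `^ (s - 1) / (c + z) by field; rewrite !gt_eqF//; lra.
  have -> : 16 * lo `^ (s - 2) = 4 * (2 ^+ 2 * lo `^ (s - 2)) by ring.
  apply: (@le_trans _ _ (4 * z `^ (s - 2))); last first.
    by rewrite ler_wpM2l// powR_half_le//; apply/andP; split; lra.
  rewrite ler_pdivrMr; last lra.
  have -> : z `^ (s - 1) = z * z `^ (s - 2).
    by rewrite -(gt0_mulr_powRB1 _ z0) (_ : s - 1 - 1 = s - 2)//; ring.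
  have p0 : 0 <= z `^ (s - 2) by exact: powR_ge0.
  have : 0 <= (4 - c) * z * z `^ (s - 2) by rewrite !mulr_ge0//; lra.
  have : 0 <= c * z `^ (s - 2) by rewrite mulr_ge0//; lra.
  by lra.
- by rewrite lx le_max lexx.
- by rewrite ly le_max lexx orbT.
Qed.

(** The two arguments of [N] differ by 2 b / a. Between them the condition on [T] keeps y above T^2
    / 2, where psi(y) <= y^(s-1). *)
Lemma shift_diff (a B b c T : R) (N : R -> R) :
  0 < s -> s < 1 -> 1 <= a -> 0 <= B ->
  `|b| <= B -> 1 <= c <= 4 -> 8 * (B + 1) <= T ->
  (forall x, is_derive x (1 : R) N
     (pospow_ratio s c (a * (Num.max x 0) ^+ 2 - (c + b ^+ 2 / a)))) ->
  `|b * (N (T + b / a) - N (T - b / a))| <= 4 * B ^+ 2 * (T ^+ 2) `^ (s - 1).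
Proof.
move=> s0 s1 a1 B0 bB /andP[c1 c4] TB dN.
have a0 : 0 < a by lra.
have c0 : 0 < c by lra.
have ba : `|b / a| <= B.
  rewrite normrM normfV (gtr0_norm a0) ler_pdivrMr//.
  by apply: (le_trans bB); nra.
have [ba1 ba2] : - B <= b / a /\ b / a <= B.
  by move: ba; rewrite ler_norml => /andP[].
have T0 : 0 < T ^+ 2 by nra.
have H : `|N (T + b / a) - N (T - b / a)|
    <= 2 * (T ^+ 2) `^ (s - 1) * `|(T + b / a) - (T - b / a)|.
  apply: (@mean_value_le _ _ _ (T - B) (T + B) _ (fun x _ => dN x)); last 2 first.
  - by apply/andP; split; lra.
  - by apply/andP; split; lra.
  move=> x /andP[x1 x2].
  rewrite max_l; last lra.
  set y := _ - _.
  have yT : T ^+ 2 / 2 <= y.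
    have b2 : b ^+ 2 / a <= B ^+ 2.
      rewrite ler_pdivrMr//.
      have : b ^+ 2 <= B ^+ 2.
        by rewrite -(ger0_norm (sqr_ge0 b)) normrX; rewrite lerXn2r ?nnegrE.
      have := sqr_ge0 B; nra.
    have x2' : (T - B) ^+ 2 <= x ^+ 2 by nra.
    have : x ^+ 2 <= a * x ^+ 2 by have := sqr_ge0 x; nra.
    by rewrite /y; nra.
  have y0 : 0 < y by lra.
  have /andP[p1 p2] := pospow_ratio_bound s0 c0 y0.
  rewrite ger0_norm//; apply: (le_trans p2).
  by apply: (@powR_half_le _ _ _ 1) => //; apply/andP; split; lra.
rewrite normrM.
have p0 := powR_ge0 (T ^+ 2) (s - 1).
have D : `|(T + b / a) - (T - b / a)| <= 2 * B.
  have -> : T + b / a - (T - b / a) = 2 * (b / a) by ring.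
  by rewrite normrM ger0_norm// ler_wpM2l.
apply: (@le_trans _ _ (B * (2 * (T ^+ 2) `^ (s - 1) * (2 * B)))); last first.
  by rewrite le_eqVlt; apply/orP; left; apply/eqP; ring.
apply: ler_pM => //; apply: (le_trans H).
by rewrite ler_wpM2l// mulr_ge0.
Qed.

(** Here [z] is the relative deviation of y = a T^2 + 2 b T - c from its leading term a T^2; it is
    of order 1/T. *)
Lemma line_power_bounds (a B b c T z : R) : 1 <= a -> 0 <= B ->
  `|b| <= B -> 1 <= c <= 4 -> 8 * (B + 1) <= T ->
  z = (2 * b * T - c) / (a * T ^+ 2) ->
  `|z| <= 2^-1 /\ z ^+ 2 <= (2 * B + 4) ^+ 2 / T ^+ 2.
Proof.
move=> a1 B0 bB /andP[c1 c4] TB zE.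
have T0 : 0 < T by lra.
have nz : `|z| <= (2 * B + 4) / T.
  rewrite zE normrM normfV (@gtr0_norm _ (a * T ^+ 2)); last by rewrite mulr_gt0 ?exprn_gt0//; lra.
  rewrite ler_pdivrMr ?mulr_gt0 ?exprn_gt0//; last lra.
  have -> : (2 * B + 4) / T * (a * T ^+ 2) = (2 * B + 4) * T * a by field; rewrite !gt_eqF//; lra.
  apply: (@le_trans _ _ ((2 * B + 4) * T)).
    have [b1 b2] : - B <= b /\ b <= B by move: bB; rewrite ler_norml => /andP[].
    by rewrite ler_norml; apply/andP; split; nra.
  by rewrite ler_peMr// mulr_ge0; lra.
split.
  apply: (le_trans nz); rewrite ler_pdivrMr//; lra.
rewrite -(ger0_norm (sqr_ge0 z)) normrX -expr_div_n lerXn2r// nnegrE.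
by rewrite divr_ge0; lra.
Qed.

(** Expand both powers around (a T^2)^s by the Bernoulli inequalities. The first-order terms in b
    cancel between b and -b, which improves the relative error from 1/T to 1/T^2. *)
Lemma line_power_diff (a B b c T : R) : 0 < s -> s < 1 -> 1 <= a -> 0 <= B ->
  `|b| <= B -> 1 <= c <= 4 -> 8 * (B + 1) <= T ->
  `|a `^ s * (T ^+ 2) `^ s - 2^-1 *
    ((a * T ^+ 2 + 2 * b * T - c) `^ s + (a * T ^+ 2 + 2 * - b * T - c) `^ s)|
    <= a `^ s * (4 + (2 * B + 4) ^+ 2) * (T ^+ 2) `^ (s - 1).
Proof.
move=> s0 s1 a1 B0 bB cI TB.
pose Y b := a * T ^+ 2 + 2 * b * T - c; rewrite -/(Y b) -/(Y (- b)).
have /andP[c1 c4] := cI.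
have T0 : 0 < T by lra.
have T20 : 0 < T ^+ 2 by rewrite exprn_gt0.
have aT0 : 0 < a * T ^+ 2 by rewrite mulr_gt0//; lra.
pose z b := (2 * b * T - c) / (a * T ^+ 2).
have bB' : `|- b| <= B by rewrite normrN.
have [z1 z1'] := @line_power_bounds a B b c T (z b) a1 B0 bB cI TB erefl.
have [z2 z2'] := @line_power_bounds a B (- b) c T (z (- b)) a1 B0 bB' cI TB erefl.
have YE b' : Y b' = a * T ^+ 2 * (1 + z b').
  by rewrite /Y /z; field; rewrite !gt_eqF//; lra.
have gez (w : R) : `|w| <= 2^-1 -> 0 <= 1 + w /\ -1 <= w.
  by rewrite ler_norml => /andP[]; lra.
have [g1 h1] := gez _ z1; have [g2 h2] := gez _ z2.
rewrite !YE !(powRM _ (ltW aT0))//.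
have a0 : 0 <= a by lra.
rewrite (powRM _ a0 (ltW T20)).
set P := a `^ s * (T ^+ 2) `^ s.
have P0 : 0 <= P by rewrite mulr_ge0 ?powR_ge0.
have -> : P - 2^-1 * (P * (1 + z b) `^ s + P * (1 + z (- b)) `^ s) =
  P * (1 - 2^-1 * ((1 + z b) `^ s + (1 + z (- b)) `^ s)) by ring.
rewrite normrM (ger0_norm P0).
have -> : a `^ s * (4 + (2 * B + 4) ^+ 2) * (T ^+ 2) `^ (s - 1) =
    P * ((4 + (2 * B + 4) ^+ 2) / T ^+ 2).
  rewrite /P -(mulr_powRB1 (ltW T20) s0); field; rewrite !gt_eqF//; lra.
rewrite ler_wpM2l//.
have U1 := powR_bernoulli_le s0 s1 h1; have U2 := powR_bernoulli_le s0 s1 h2.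
have L1 := powR_bernoulli_ge s0 s1 z1; have L2 := powR_bernoulli_ge s0 s1 z2.
(* All that is left of the first-order terms; at most 8 / T^2 in size, and the averaging factor 1/2
   turns 8 into the 4 of the claim. *)
have zz : s * z b + s * z (- b) = - (2 * s * c / a) / T ^+ 2.
  by rewrite /z; field; rewrite !gt_eqF//; lra.
have sc : 0 <= 2 * s * c / a <= 8.
  rewrite divr_ge0 ?mulr_ge0 ?(ltW s0)//=; last lra.
  rewrite ler_pdivrMr; last lra.
  by nra.
have /andP[sc1 sc2] := sc.
have scT : 0 <= 2 * s * c / a / T ^+ 2 <= 8 / T ^+ 2.
  by rewrite divr_ge0 ?(ltW T20)//= ler_wpM2r// invr_ge0 ltW.
have /andP[scT1 scT2] := scT.
rewrite mulrDl; move: zz; rewrite mulNr => zz.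
have q0 : 0 <= (2 * B + 4) ^+ 2 / T ^+ 2.
  by rewrite divr_ge0 ?sqr_ge0// ltW.
have t0 : 0 <= 4 / T ^+ 2 by rewrite divr_ge0// ltW.
have e8 : 8 / T ^+ 2 = 2 * (4 / T ^+ 2) by ring.
by rewrite ler_norml; apply/andP; split; lra.
Qed.

(* The main part (T ^ 2) ^ s / s - Psi (T ^ 2) does not involve a, so it cancels
   in a combination whose coefficients sum to 0. *)
Lemma line_asymptotic (a B : R) : 0 < s -> s < 1 -> 1 <= a -> 0 <= B ->
  exists K : R, forall (b c T : R) (Psi N : R -> R),
  `|b| <= B -> 1 <= c <= 4 -> 8 * (B + 1) <= T ->
  (forall x, is_derive x (1 : R) Psi (pospow_ratio s c x)) ->
  (forall x, is_derive x (1 : R) N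
     (pospow_ratio s c (a * (Num.max x 0) ^+ 2 - (c + b ^+ 2 / a)))) ->
  `|a `^ s * (T ^+ 2) `^ s / s + (line_antiderivative Psi N a b c T^-1
      + line_antiderivative Psi N a (- b) c T^-1) - ((T ^+ 2) `^ s / s - Psi (T ^+ 2))| <= K * (T ^+ 2) `^ (s - 1).
Proof.
move=> s0 s1 a1 B0.
(* One summand for each source of error: [line_power_diff] divided by s, [potential_diff] between
   T^2 and y for b and -b with weight 1/2 each, and [shift_diff]. *)
exists (a `^ s * (4 + (2 * B + 4) ^+ 2) / s + 16 * (2 * a) + 4 * B ^+ 2).
move=> b c T Psi N bB cI TB dPsi dN.
have T0 : 0 < T by have := B0; lra.
have T20 : 0 < T ^+ 2 by rewrite exprn_gt0.
have /andP[c1 c4] := cI.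
pose Y b := a * T ^+ 2 + 2 * b * T - c.
have S := shift_diff s0 s1 a1 B0 bB cI TB dN.
have W := line_power_diff s0 s1 a1 B0 bB cI TB; rewrite -/(Y b) -/(Y (- b)) in W.
have aT0 : 0 < a * T ^+ 2 by rewrite mulr_gt0//; lra.
have Yb b' : `|b'| <= B -> T ^+ 2 / 2 <= Y b' <= 2 * a * T ^+ 2.
  move=> bB'.
  have [z _] := @line_power_bounds a B b' c T _ a1 B0 bB' cI TB erefl.
  have -> : Y b' = a * T ^+ 2 * (1 + (2 * b' * T - c) / (a * T ^+ 2)).
    by rewrite /Y; field; rewrite !gt_eqF//; lra.
  move: z; set z := (_ / _); rewrite ler_norml => /andP[z1 z2].
  have aT : T ^+ 2 <= a * T ^+ 2 by rewrite ler_peMl// ltW.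
  by apply/andP; split; nra.
have V b' : `|b'| <= B -> `|(Y b' `^ s / s - Psi (Y b')) -
     ((T ^+ 2) `^ s / s - Psi (T ^+ 2))| <= 16 * (2 * a) * (T ^+ 2) `^ (s - 1).
  move=> bB'; have /andP[Y1 Y2] := Yb _ bB'.
  have cc : 0 < c <= 4 by apply/andP; split; lra.
  have T2T : T ^+ 2 / 2 <= T ^+ 2 by lra.
  apply: (le_trans (potential_diff s0 s1 cc T20 dPsi T2T Y1)).
  have -> : (T ^+ 2) `^ (s - 1) = T ^+ 2 * (T ^+ 2) `^ (s - 2).
    by rewrite -(gt0_mulr_powRB1 _ T20) (_ : s - 1 - 1 = s - 2)//; ring.
  have -> : 16 * (2 * a) * (T ^+ 2 * (T ^+ 2) `^ (s - 2)) =
    16 * (T ^+ 2) `^ (s - 2) * (2 * a * T ^+ 2) by ring.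
  rewrite ler_wpM2l ?mulr_ge0 ?powR_ge0//.
  have aT : T ^+ 2 <= a * T ^+ 2 by rewrite ler_peMl// ltW.
  by rewrite ler_norml; apply/andP; split; lra.
have V1 := V b bB; have V2 := V (- b) _; rewrite normrN in V2; have {}V2 := V2 bB.
have lE b' : line_ratio a b' c T^-1 = Y b' by rewrite /line_ratio invrK.
rewrite /line_antiderivative !lE invrK mulNr (_ : - b / a = - (b / a)) ?mulNr//.
set E := (X in `|X|).
have -> : E = (a `^ s * (T ^+ 2) `^ s - 2^-1 * (Y b `^ s + Y (- b) `^ s)) / s
  + 2^-1 * ((Y b `^ s / s - Psi (Y b)) - ((T ^+ 2) `^ s / s - Psi (T ^+ 2)))
  + 2^-1 * ((Y (- b) `^ s / s - Psi (Y (- b))) - ((T ^+ 2) `^ s / s - Psi (T ^+ 2)))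
  - b * (N (T + b / a) - N (T - b / a)).
  by rewrite /E; field; rewrite !gt_eqF//; lra.
set p := (T ^+ 2) `^ (s - 1).
have KE (x y z : R) : (x + y + z) * p = x * p + y * p + z * p by ring.
rewrite {}KE.
have tri (x y z w : R) : `|x + y + z - w| <= `|x| + `|y| + `|z| + `|w|.
  apply: (le_trans (ler_normB _ _)); rewrite lerD2r.
  by apply: (le_trans (ler_normD _ _)); rewrite lerD2r; exact: ler_normD.
apply: (le_trans (tri _ _ _ _)); rewrite lerD//.
rewrite -addrA lerD//.
  rewrite normrM normfV (gtr0_norm s0) ler_pdivrMr// mulrAC divfK//.
  by rewrite gt_eqF.
by rewrite !normrM (@ger0_norm _ 2^-1) ?invr_ge0//; move: V1 V2; rewrite -/p; lra.
Qed.

End line_asymptotic.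

(** * The truncated integral over a half-line for a combination with coefficients summing to 0 *)

Section line_integral.
Context (R : realType).
Implicit Types s a b c r : R.

Lemma line_ratio_eventually_le0 a b c : 0 < c ->
  \forall r \near +oo, line_ratio a b c r <= 0.
Proof.
move=> c0; pose M := `|a| + 2 * `|b|.
have M0 : 0 <= M by rewrite addr_ge0// mulr_ge0.
near=> r.
have r1 : 1 <= r by near: r; apply: nbhs_pinfty_ge; rewrite num_real.
have rM : M / c <= r by near: r; apply: nbhs_pinfty_ge; rewrite num_real.
have r0 : 0 < r by exact: lt_le_trans r1.
have Mr : M * r^-1 <= c by rewrite ler_pdivrMr// mulrC -ler_pdivrMr.
rewrite /line_ratio subr_le0; apply: le_trans Mr.
have v0 : 0 <= r^-1 by rewrite invr_ge0 ltW.
have v1 : r^-1 ^+ 2 <= r^-1 by rewrite expr2 ler_piMl// invf_le1.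
rewrite [leRHS](_ : _ = `|a| * r^-1 + 2 * `|b| * r^-1); last by rewrite /M; ring.
rewrite lerD//.
  apply: (@le_trans _ _ (`|a| * r^-1 ^+ 2)); last by rewrite ler_wpM2l.
  by rewrite ler_wpM2r ?sqr_ge0// ler_norm.
by rewrite ler_wpM2r// ler_wpM2l// ler_norm.
Unshelve. all: by end_near. Qed.

(** Far out the line has left the ball, so y <= 0. By completing the square this says that |1/r +
    b/a| is below the threshold, so both primitives are evaluated where they vanish. *)
Lemma line_antiderivative_eventually0 a b c (Psi N : R -> R) : 0 < a -> 0 < c ->
  (forall x, x <= 0 -> Psi x = 0) ->
  (forall x, x <= Num.sqrt ((c + b ^+ 2 / a) / a) -> N x = 0) ->
  \forall r \near +oo, line_antiderivative Psi N a b c r = 0.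
Proof.
move=> a0 c0 Psi0 N0; near=> r.
have r0 : 0 < r by near: r; apply: nbhs_pinfty_gt; rewrite num_real.
have y0 : line_ratio a b c r <= 0.
  by near: r; exact: line_ratio_eventually_le0.
rewrite /line_antiderivative Psi0// N0 ?mulr0 ?addr0 ?oppr0//.
apply: (le_trans (ler_norm _)); rewrite -sqrtr_sqr ler_wsqrtr//.
rewrite ler_pdivlMr// -subr_le0 mulrC; apply: le_trans y0.
rewrite le_eqVlt; apply/orP; left; apply/eqP.
by rewrite /line_ratio; field; rewrite !gt_eqF.
Unshelve. all: by end_near. Qed.

(** The threshold is the nonnegative zero of a x^2 - (c + b^2 / a). Only b^2 enters, so the same [N]
    serves b and -b. *)
Lemma shift_primitive s a b c : 0 < s -> 0 < a -> 0 < c ->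
  exists N : R -> R,
  (forall x : R, is_derive x 1 N
     (pospow_ratio s c (a * (Num.max x 0) ^+ 2 - (c + b ^+ 2 / a)))) /\
  (forall x, x <= Num.sqrt ((c + b ^+ 2 / a) / a) -> N x = 0).
Proof.
move=> s0 a0 c0; apply: (primitive_exists (p := Num.sqrt ((c + b ^+ 2 / a) / a))).
  move=> x.
  have cf : {for x, continuous (fun x : R => a * Num.max x 0 ^+ 2 - (c + b ^+ 2 / a))}.
    apply: cvgB; last exact: cvg_cst.
    apply: cvgM; first exact: cvg_cst.
    have cm : Num.max y 0 @[y --> x] --> Num.max (x : R) 0.
      exact: (continuous_max cvg_id (cvg_cst _)).
    exact: (cvgM cm cm).
  apply: (continuous_comp cf); exact: pospow_ratio_continuous.
move=> x xs; rewrite pospow_ratio_le0// subr_le0.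
have D0 : 0 <= c + b ^+ 2 / a.
  by rewrite addr_ge0 ?(ltW c0)// divr_ge0 ?sqr_ge0// ltW.
rewrite mulrC -ler_pdivlMr// -(sqr_sqrtr (divr_ge0 D0 (ltW a0))).
rewrite lerXn2r// ?nnegrE ?sqrtr_ge0 ?le_max ?lexx ?orbT//.
by rewrite ge_max xs sqrtr_ge0.
Qed.

Lemma cvg_powRN_pinfty (p : R) : 0 < p -> r `^ (- p) @[r --> +oo%R] --> (0 : R).
Proof.
move=> p0; apply/cvgrPdist_lt => /= e e0; near=> r.
have d0 : 0 < e `^ p^-1 by exact: powR_gt0.
have r0 : 0 < r by near: r; apply: nbhs_pinfty_gt; rewrite num_real.
have rd : (e `^ p^-1)^-1 < r by near: r; apply: nbhs_pinfty_gt; rewrite num_real.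
rewrite sub0r normrN ger0_norm ?powR_ge0//.
rewrite -mulN1r powRrM powR_inv1 ?(ltW r0)//.
rewrite [ltRHS](_ : e = (e `^ p^-1) `^ p); last first.
  by rewrite -powRrM mulVf ?gt_eqF// powRr1// ltW.
apply: gt0_ltr_powR => //; rewrite ?nnegrE ?invr_ge0 ?(ltW r0) ?(ltW d0)//.
by rewrite -[ltRHS]invrK ltf_pV2// posrE ?invr_gt0.
Unshelve. all: by end_near. Qed.

Lemma cvg_sumr (T I : Type) (F : set_system T) (FF : Filter F) (e : seq I)
    (f : I -> T -> R) (l : I -> R) :
  (forall i, f i x @[x --> F] --> l i) ->
  \sum_(i <- e) f i x @[x --> F] --> \sum_(i <- e) l i.
Proof.
move=> fl; elim: e => [|i e IH].
  by rewrite big_nil; under eq_fun do rewrite big_nil; exact: cvg_cst.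
by rewrite big_cons; under eq_fun do rewrite big_cons; exact: cvgD.
Qed.

Lemma is_derive_sumf n (h : 'I_n -> R -> R) (x : R) (dh : 'I_n -> R) :
  (forall i, is_derive x 1 (h i) (dh i)) ->
  is_derive x 1 (fun y => \sum_(i < n) h i y) (\sum_(i < n) dh i).
Proof. by move=> H; have := is_derive_sum H; rewrite fct_sumE. Qed.

(** [C] is a constant large enough to make the integrand nonnegative, so that the fundamental
    theorem on a half-line applies. It contributes exactly C T^(2s) / (2s); everything else is of
    order T^(2s-2), uniformly in [b] and [c]. *)
Lemma line_integral n (lam a : 'I_n -> R) s B : 0 < s -> s < 1 ->
  \sum_(i < n) lam i = 0 -> (forall i, 1 <= a i) -> 0 <= B ->
  exists K : R, forall b c T C : R,
  `|b| <= B -> 1 <= c <= 4 -> 8 * (B + 1) <= T ->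
  let D r := 2 * (\sum_(i < n) lam i * a i `^ s)
    - \sum_(i < n) lam i * (pospow s (a i + 2 * b * r - c * r ^+ 2) +
                             pospow s (a i + 2 * (- b) * r - c * r ^+ 2)) in
  (forall r, 0 < r -> 0 <= C + D r) ->
  exists2 E, `|E| <= K * (T ^+ 2) `^ (s - 1) &
  (\int[lebesgue_measure]_(r in `[(T^-1)%R, +oo[)
     ((C + D r) / r `^ (1 + 2 * s))%R%:E)%E
    = (C * (T ^+ 2) `^ s / (2 * s) + E)%:E.
Proof.
move=> s0 s1 lam0 a1 B0.
have /choice[K KP] := fun i => line_asymptotic s0 s1 (a1 i) B0.
exists (\sum_(i < n) `|lam i| * K i) => b c T C bB cI TB.
have /andP[c1 c4] := cI; have c0 : 0 < c by lra.
have a0 i : 0 < a i by have := a1 i; lra.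
have T0 : 0 < T by lra.
pose q b i r := a i + 2 * b * r - c * r ^+ 2.
set U := \sum_(i < n) lam i * a i `^ s.
move=> D D0.
have [||Psi [dPsi Psi0]] := @primitive_exists R (pospow_ratio s c) 0.
- exact: pospow_ratio_continuous.
- by move=> x; exact: pospow_ratio_le0.
have /choice[N NP] := fun i => shift_primitive b s0 (a0 i) c0.
pose P r := \sum_(i < n) lam i * (line_antiderivative Psi (N i) (a i) b c r +
    line_antiderivative Psi (N i) (a i) (- b) c r).
pose F r := - ((C + 2 * U) / (2 * s)) * r `^ (- (2 * s)) - P r.
have s20 : 0 < 2 * s by lra.
pose f r := (C + D r) / r `^ (1 + 2 * s).
have dF (r : R) : 0 < r -> is_derive r 1 F (f r).
  move=> r0.
  have d1 := is_derive1_powR (- (2 * s)) r0.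
  have d2 : is_derive r 1 P (\sum_(i < n) lam i *
      ((pospow s (q b i r) / r `^ (1 + 2 * s)) +
       (pospow s (q (- b) i r) / r `^ (1 + 2 * s)))).
    apply: is_derive_sumf => i.
    have [dN _] := NP i.
    have e1 := is_derive_line_antiderivative s0 (a0 i) c0 dPsi dN r0.
    have e2 := @is_derive_line_antiderivative _ _ s0 _ (- b) _ _ (N i) (a0 i) c0 dPsi.
    rewrite sqrrN in e2; have {}e2 := e2 dN _ r0.
    exact: (is_deriveZ (lam i) (is_deriveD e1 e2)).
  apply: is_derive_eq; rewrite /GRing.scale/=.
  rewrite (_ : - (2 * s) - 1 = - (1 + 2 * s)); last by ring.
  rewrite powRN /f /D; set w := r `^ (1 + 2 * s).
  have w0 : 0 < w by exact: powR_gt0.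
  under eq_bigr do rewrite -mulrDl mulrA.
  rewrite -mulr_suml -/q; set S := \sum_(i < n) _.
  by field; rewrite !gt_eqF.
have F0 : F r @[r --> +oo%R] --> (0 : R).
  rewrite -[X in _ --> X](subr0 (0 : R)); apply: cvgB.
    rewrite -[X in _ --> X](mulr0 (- ((C + 2 * U) / (2 * s)))); apply: cvgM.
      exact: cvg_cst.
    exact: cvg_powRN_pinfty.
  apply: cvg_near_cst; rewrite /P.
  have Q0 : \forall r \near +oo, forall i,
      line_antiderivative Psi (N i) (a i) b c r = 0.
    apply: filter_forall => i; have [_ N0] := NP i.
    exact: line_antiderivative_eventually0.
  have Q0' : \forall r \near +oo, forall i,
      line_antiderivative Psi (N i) (a i) (- b) c r = 0.
    apply: filter_forall => i; have [_ N0] := NP i.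
    by apply: line_antiderivative_eventually0; rewrite ?sqrrN.
  near=> r; rewrite big1// => i _.
  by rewrite (near Q0 r)// (near Q0' r)// addr0 mulr0.
have T'0 : 0 < T^-1 by rewrite invr_gt0.
exists (U * (T ^+ 2) `^ s / s + P T^-1); last first.
  rewrite (@ge0_continuous_FTC2y _ f F T^-1 0).
  - rewrite /F -EFinB; congr (_%:E).
    have -> : T^-1 `^ (- (2 * s)) = (T ^+ 2) `^ s.
      rewrite -(powR_inv1 (ltW T0)) -powRrM -(powR_mulrn 2 (ltW T0)) -powRrM.
      by congr (_ `^ _); ring.
    by field; rewrite gt_eqF.
  - move=> r Tr; rewrite divr_ge0 ?powR_ge0//; apply: D0.
    exact: lt_le_trans Tr.
  - apply: continuous_in_subspaceT => r; rewrite inE/= in_itv/= andbT => Tr.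
    have r0 : 0 < r by exact: lt_le_trans Tr.
    have cq (b' : R) i : {for r, continuous (fun r : R =>
        pospow s (a i + 2 * b' * r - c * r ^+ 2))}.
      have cp : {for r, continuous (fun r : R => a i + 2 * b' * r - c * r ^+ 2)}.
        apply: cvgB; last first.
          apply: cvgM; first exact: cvg_cst.
          exact: (cvgM cvg_id cvg_id).
        apply: cvgD; first exact: cvg_cst.
        by apply: cvgM; [exact: cvg_cst|exact: cvg_id].
      by apply: (continuous_comp cp); exact: pospow_continuous.
    apply: cvgM; last first.
      apply: cvgV; first by rewrite gt_eqF// powR_gt0.
      have : {for r, continuous (fun x : R => x `^ (1 + 2 * s))}; last exact.
      apply/differentiable_continuous/derivable1_diffP.
      by apply: derivable_powR; rewrite in_itv/= r0.
    apply: cvgD; first exact: cvg_cst.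
    apply: cvgB; first exact: cvg_cst.
    apply: cvg_sumr => i; apply: cvgM; first exact: cvg_cst.
    by apply: cvgD; exact: cq.
  - exact: F0.
  - by move=> r Tr; have [] := dF r (lt_trans T'0 Tr).
  - have [dFT _] := dF _ T'0.
    apply: cvg_at_right_filter; apply: differentiable_continuous.
    exact/derivable1_diffP.
  - move=> r; rewrite in_itv/= andbT => Tr.
    by rewrite derive1E; have [_ ->] := dF r (lt_trans T'0 Tr).
(* [Z] is the same for every i, so it can be subtracted inside the sum at no cost because the
   [lam i] sum to 0. Each summand is then bounded by [line_asymptotic]. *)
set Z := (T ^+ 2) `^ s / s - Psi (T ^+ 2).
have -> : U * (T ^+ 2) `^ s / s + P T^-1 = \sum_(i < n) lam i *
   (a i `^ s * (T ^+ 2) `^ s / s +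
      (line_antiderivative Psi (N i) (a i) b c T^-1 +
       line_antiderivative Psi (N i) (a i) (- b) c T^-1) - Z).
  under [RHS]eq_bigr do rewrite mulrBr mulrDr.
  rewrite sumrB big_split/= -mulr_suml lam0 mul0r subr0 /P; congr (_ + _).
  by rewrite /U !mulr_suml; apply: eq_bigr => i _; ring.
apply: (le_trans (ler_norm_sum _ _ _)); rewrite mulr_suml.
apply: ler_sum => i _; rewrite normrM -[leRHS]mulrA ler_wpM2l//.
by apply: KP => //; have [] := NP i.
Unshelve. all: by end_near. Qed.
End line_integral.

(** * Scaling and polar coordinates *)

Definition pushforward_measure d d' (T1 : measurableType d)
    (T2 : measurableType d') (R : realType) (mu : {measure set T1 -> \bar R})
    (f : T1 -> T2) (mf : measurable_fun setT f) : {measure set T2 -> \bar R} :=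
  measure_function_pushforward__canonical__measure_function_Measure mu mf.

(** The rescaled image measure agrees with Lebesgue measure on the intervals []a, b]], hence
    everywhere. Negative r, for which the preimage is closed on the left instead, is needed for the
    reflection y -> -y. *)
Lemma lebesgue_integral_scale (R : realType) (r : R) (f : measurableTypeR R -> \bar R) :
  r != 0 -> measurable_fun setT f -> (forall x, (0 <= f x)%E) ->
  (\int[lebesgue_measure]_x f x
    = `|r|%:E * \int[lebesgue_measure]_x f (r * x)%R)%E.
Proof.
move=> r0 mf f0.
have mr : measurable_fun setT ( *%R r : measurableTypeR R -> measurableTypeR R).
  exact: mulrl_measurable.
pose m := mscale (NngNum (normr_ge0 r)) (pushforward_measure (@lebesgue_measure R) mr).
have mE A : measurable A -> lebesgue_measure A = m A.
  apply: (@lebesgue_measure_unique R) => _ [[a b] _ <-] /=.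
  rewrite /m /mscale/= /pushforward lebesgue_measure_itv/= lte_fin.
  have [r_gt0|r_lt0] := ltrP 0 r.
    rewrite (_ : _ @^-1` _ = `]a / r, b / r]%classic); last first.
      apply/seteqP; split=> x /=; rewrite !in_itv/=.
        by rewrite ltr_pdivrMr// ler_pdivlMr// mulrC.
      by rewrite ltr_pdivrMr// ler_pdivlMr// mulrC.
    rewrite lebesgue_measure_itv/= lte_fin ltr_pM2r ?invr_gt0//.
    case: ifPn => _; last by rewrite mule0.
    rewrite -!EFinB -EFinM gtr0_norm//; congr (_%:E).
    by field.
  have {}r_lt0 : r < 0 by rewrite lt_neqAle r0.
  rewrite (_ : _ @^-1` _ = `[b / r, a / r[%classic); last first.
    apply/seteqP; split=> x /=; rewrite !in_itv/=.
      by rewrite ltr_ndivlMr// ler_ndivrMr// mulrC andbC.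
    by rewrite ltr_ndivlMr// ler_ndivrMr// mulrC andbC.
  rewrite lebesgue_measure_itv/= lte_fin ltr_nM2r ?invr_lt0//.
  case: ifPn => _; last by rewrite mule0.
  rewrite -!EFinB -EFinM ltr0_norm//; congr (_%:E).
  by field.
transitivity (\int[m]_x f x)%E.
  by apply: eq_measure_integral => A mA _; exact: mE.
rewrite /m ge0_integral_mscale//; congr (_ * _)%E.
by rewrite ge0_integral_pushforward.
Qed.

Section tuple_scaling.
Context (R : realType).
Implicit Types (n : nat) (r : R).

Definition scale_tuple n r (t : n.-tuple (measurableTypeR R)) :
  n.-tuple (measurableTypeR R) := [tuple r * tnth t i | i < n].

Lemma rV_of_scale_tuple n r t :
  rV_of_tuple (@scale_tuple n r t) = r *: rV_of_tuple t.
Proof. by apply/rowP => i; rewrite !mxE tnth_mktuple. Qed.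

Lemma measurable_scale_tuple n r : measurable_fun setT (@scale_tuple n r).
Proof.
apply/measurable_fun_tnthP => i.
apply: (eq_measurable_fun (fun t : n.-tuple (measurableTypeR R) => r * tnth t i)).
  by move=> t _ /=; rewrite tnth_mktuple.
apply: measurable_funM => //; exact: measurable_tnth.
Qed.

Lemma measurable_scale_tuple2 n :
  measurable_fun setT (fun p : measurableTypeR R * n.-tuple (measurableTypeR R) =>
    scale_tuple p.1 p.2).
Proof.
apply/measurable_fun_tnthP => i.
apply: (eq_measurable_fun (fun p : measurableTypeR R * n.-tuple (measurableTypeR R) =>
  p.1 * tnth p.2 i)).
  by move=> t _ /=; rewrite tnth_mktuple.
apply: measurable_funM => //.
exact: (measurableT_comp (measurable_tnth i) measurable_snd).
Qed.

Lemma lebesgue_tuple_integralS n (f : n.+1.-tuple (measurableTypeR R) -> \bar R) :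
  measurable_fun setT f -> (forall t, (0 <= f t)%E) ->
  (\int[lebesgue_tuple R n.+1]_t f t =
   \int[lebesgue_measure]_x \int[lebesgue_tuple R n]_t f (tcons (x, t)))%E.
Proof.
move=> mf f0.
have mc := @measurable_tcons R n.
rewrite [LHS](_ : _ = \int[pushforward (@lebesgue_measure R \x lebesgue_tuple R n)%E
  (@tcons R n)]_t f t)%E//.
rewrite ge0_integral_pushforward// preimage_setT.
rewrite (fubini_tonelli1 (f \o @tcons R n))//; last by move=> x /=.
exact: (measurableT_comp mf mc).
Qed.

(** Induction on the dimension: each coordinate contributes one factor |r| through Tonelli. *)
Lemma lebesgue_tuple_scale n r (f : n.-tuple (measurableTypeR R) -> \bar R) :
  r != 0 -> measurable_fun setT f -> (forall t, (0 <= f t)%E) ->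
  (\int[lebesgue_tuple R n]_t f t
     = (`|r| ^+ n)%:E * \int[lebesgue_tuple R n]_t f (scale_tuple r t))%E.
Proof.
move=> r0; elim: n => [|n IH] in f * => mf f0.
  rewrite expr0 mul1e; apply: eq_integral => t _; congr (f _).
  by rewrite [LHS]tuple0 [RHS]tuple0.
have mc := @measurable_tcons R n.
have mfr : measurable_fun setT (f \o scale_tuple r).
  exact: measurableT_comp mf (@measurable_scale_tuple _ r).
rewrite lebesgue_tuple_integralS// [in RHS]lebesgue_tuple_integralS//.
have mfc x : measurable_fun setT (fun t => f (tcons (x, t))).
  apply: measurableT_comp => //; apply: measurableT_comp => //.
have scE x t : scale_tuple r (tcons (x, t)) = tcons (r * x, scale_tuple r t).
  apply: eq_from_tnth => i; rewrite tnth_mktuple.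
  have [j ->|->] := unliftP ord0 i; first by rewrite !tnthS tnth_mktuple.
  by rewrite !tnth0.
under [in RHS]eq_integral do under eq_integral do rewrite scE.
pose h (p : measurableTypeR R * n.-tuple (measurableTypeR R)) :=
  f (tcons (p.1, scale_tuple r p.2)).
have mh : measurable_fun setT h.
  apply: (measurableT_comp mf); apply: (measurableT_comp mc).
  apply: measurable_fun_pair; first exact: measurable_fst.
  exact: (measurableT_comp (@measurable_scale_tuple n r) measurable_snd).
pose G x := (\int[lebesgue_tuple R n]_t h (x, t))%E.
have mG : measurable_fun setT G.
  exact: (measurable_fun_fubini_tonelli_F h mh (fun p => f0 _)).
have G0 x : (0 <= G x)%E by apply: integral_ge0 => t _; exact: f0.
transitivity (\int[lebesgue_measure]_x ((`|r| ^+ n)%:E * G x))%E.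
  by apply: eq_integral => x _; exact: (IH (fun t => f (tcons (x, t)))).
have r'0 : (0 <= (`|r| ^+ n)%:E)%E by rewrite lee_fin exprn_ge0.
rewrite (ge0_integralZl _ measurableT mG (fun x _ => G0 x) r'0).
rewrite (@lebesgue_integral_scale _ r)// muleA -EFinM -exprSr.
by [].
Qed.
End tuple_scaling.

Section enorm.
Context (R : realType) (n : nat).
Implicit Types (x y : 'rV[R]_n) (r : R).

Lemma dot_ge0 x : 0 <= dot x x.
Proof. by apply: sumr_ge0 => i _; rewrite -expr2 sqr_ge0. Qed.

Lemma enorm_ge0 x : 0 <= enorm x.
Proof. exact: sqrtr_ge0. Qed.

Lemma sqr_enorm x : enorm x ^+ 2 = dot x x.
Proof. by rewrite sqr_sqrtr ?dot_ge0. Qed.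

Lemma dotZ r x y : dot (r *: x) (r *: y) = r ^+ 2 * dot x y.
Proof. by rewrite /dot mulr_sumr; apply: eq_bigr => i _; rewrite !mxE; ring. Qed.

Lemma enormZ r x : enorm (r *: x) = `|r| * enorm x.
Proof. by rewrite /enorm dotZ sqrtrM ?sqr_ge0// sqrtr_sqr. Qed.

End enorm.

Section polar.
Context (R : realType) (n : nat).
Local Notation T := (n.-tuple (measurableTypeR R)).
Local Notation mu := (lebesgue_tuple R n).

Definition tuple_norm (t : T) : R := enorm (rV_of_tuple t).

Lemma tuple_norm_ge0 t : 0 <= tuple_norm t.
Proof. exact: enorm_ge0. Qed.

Lemma tuple_norm_scale r t : 0 <= r -> tuple_norm (scale_tuple r t) = r * tuple_norm t.
Proof. by move=> r0; rewrite /tuple_norm rV_of_scale_tuple enormZ ger0_norm. Qed.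

Lemma measurable_rV_coord i : measurable_fun setT (fun t : T => rV_of_tuple t 0 i).
Proof.
apply: (eq_measurable_fun (fun t : T => tnth t i)).
  by move=> t _; rewrite mxE.
exact: measurable_tnth.
Qed.

Lemma measurable_tuple_norm : measurable_fun setT tuple_norm.
Proof.
apply: (measurableT_comp (continuous_measurable_fun (@sqrt_continuous R))).
apply: measurable_sum => i.
by apply: measurable_funM; exact: measurable_rV_coord.
Qed.

Definition shell : set T := [set t | 1 <= tuple_norm t <= 2].

(** A weight read in two ways. For fixed x > 0 its integral in r is that of 1/r over [x/2, x], that
    is ln 2; for fixed r > 0 it cuts out the shell dilated by r. *)
Let w (r x : R) : R :=
  if (0 < r) && ((r <= x) && (x <= 2 * r)) then r `^ (-1) else 0.

Let w_ge0 r x : 0 <= w r x.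
Proof. by rewrite /w; case: ifP => _ //; exact: powR_ge0. Qed.

Let measurable_w : measurable_fun setT
  (fun p : measurableTypeR R * T => w p.1 (tuple_norm p.2)).
Proof.
have m2 := measurableT_comp measurable_tuple_norm
  (measurable_snd (T1 := measurableTypeR R) (T2 := T)).
have m1 := measurable_fst (T1 := measurableTypeR R) (T2 := T).
apply: measurable_fun_ifT => //; last first.
  exact: (measurableT_comp (measurable_powR (-1)) m1).
apply: measurable_and; first by apply: measurable_fun_ltr => //; exact: measurable_id.
apply: measurable_and; first by apply: measurable_fun_ler => //; exact: measurable_id.
by apply: measurable_fun_ler => //; exact: measurable_funM.
Qed.

Let integral_w x : 0 < x ->
  (\int[lebesgue_measure]_r (w r x)%:E)%E = (ln 2)%:E.
Proof.
move=> x0.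
have x20 : 0 < x / 2 by rewrite divr_gt0.
have xx : x / 2 < x by lra.
rewrite [LHS](_ : _ = \int[lebesgue_measure]_(r in `[(x / 2)%R, x]) (r `^ (-1))%:E)%E; last first.
  rewrite [RHS]integral_mkcond; apply: eq_integral => r _.
  rewrite patchE /w; case: ifPn => [/and3P[r0 rx xr]|].
    by rewrite mem_set//= in_itv/= rx andbT ler_pdivrMr// mulrC.
  move=> h; rewrite memNset//= in_itv/=; apply: contraNnot h => /andP[h1 h2].
  by rewrite h2 (lt_le_trans x20 h1)/= mulrC -ler_pdivrMr.
rewrite (@continuous_FTC2 _ _ (@ln R) _ _ xx).
- rewrite -EFinB ln_div ?posrE//; congr (_%:E); ring.
- apply: continuous_in_subspaceT => r; rewrite inE/= in_itv/= => /andP[xr _].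
  apply/differentiable_continuous/derivable1_diffP.
  by apply: derivable_powR; rewrite in_itv/= (lt_le_trans x20 xr).
- split.
  + move=> r; rewrite in_itv/= => /andP[xr _].
    by have [] := is_derive1_ln (lt_trans x20 xr).
  + exact/cvg_at_right_filter/continuous_ln.
  + exact/cvg_at_left_filter/continuous_ln.
- move=> r; rewrite in_itv/= => /andP[xr _].
  have r0 := lt_trans x20 xr.
  by rewrite derive1E; have [_ ->] := is_derive1_ln r0; rewrite powR_inv1// ltW.
Qed.

(** Insert the weight [w], exchange the integrals, replace z by r z for each fixed r, and exchange
    back. At the origin the integral of the weight is 0 instead of ln 2, which is why [f] has to
    vanish there. *)
Lemma polar_coordinates (f : T -> \bar R) :
  measurable_fun setT f -> (forall t, (0 <= f t)%E) ->
  (forall t, tuple_norm t = 0 -> f t = 0%E) ->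
  ((ln 2)%:E * \int[mu]_t f t = \int[mu]_(t in shell)
    \int[lebesgue_measure]_(r in `]0%R, +oo[)
      (f (scale_tuple r t) * (r ^+ n / r)%:E))%E.
Proof.
move=> mf f0 fz.
pose g (p : measurableTypeR R * T) := ((w p.1 (tuple_norm p.2))%:E * f p.2)%E.
have mg : measurable_fun setT g.
  apply: emeasurable_funM.
    by apply/measurable_EFinP; exact: measurable_w.
  exact: (measurableT_comp mf measurable_snd).
have g0 p : (0 <= g p)%E by rewrite mule_ge0// lee_fin w_ge0.
have mwx x : measurable_fun setT (fun r : measurableTypeR R => w r x).
  apply: measurable_fun_ifT => //.
  apply: measurable_and; first by apply: measurable_fun_ltr => //; exact: measurable_id.
  apply: measurable_and; first by apply: measurable_fun_ler => //; exact: measurable_id.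
  by apply: measurable_fun_ler => //; exact: measurable_funM.
transitivity (\int[mu]_t \int[lebesgue_measure]_r g (r, t))%E.
  rewrite -ge0_integralZl//; last by rewrite lee_fin ln_ge0// ler1n.
  apply: eq_integral => t _; rewrite /g /=.
  rewrite ge0_integralZr//; last 2 first.
  - exact/measurable_EFinP.
  - by move=> r _; rewrite lee_fin w_ge0.
  have [t0|t0] := eqVneq (tuple_norm t) 0; first by rewrite fz// !mule0.
  by rewrite integral_w// lt_neqAle eq_sym t0 tuple_norm_ge0.
transitivity (\int[lebesgue_measure]_r \int[mu]_t g (r, t))%E.
  exact/esym/(fubini_tonelli g mg g0).
(* [g] after the substitution of r z for z: the Jacobian r^n joins the weight 1/r, and r <= r |z| <=
   2 r becomes the condition that z lies in the shell. *)
pose h (p : measurableTypeR R * T) :=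
  ((if (0 < p.1) && ((1 <= tuple_norm p.2) && (tuple_norm p.2 <= 2))
    then p.1 ^+ n * p.1 `^ (-1) else 0)%:E * f (scale_tuple p.1 p.2))%E.
have mh : measurable_fun setT h.
  have m2 := measurableT_comp measurable_tuple_norm
    (measurable_snd (T1 := measurableTypeR R) (T2 := T)).
  have m1 := measurable_fst (T1 := measurableTypeR R) (T2 := T).
  apply: emeasurable_funM; last exact: (measurableT_comp mf (@measurable_scale_tuple2 _ _)).
  apply/measurable_EFinP; apply: measurable_fun_ifT => //; last first.
    apply: measurable_funM; first exact: measurable_funX.
    exact: (measurableT_comp (measurable_powR (-1)) m1).
  apply: measurable_and; first by apply: measurable_fun_ltr => //; exact: measurable_id.
  by apply: measurable_and; exact: measurable_fun_ler.
have h0 p : (0 <= h p)%E.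
  rewrite mule_ge0// lee_fin; case: ifP => // /andP[p0 _].
  by rewrite mulr_ge0 ?powR_ge0// exprn_ge0// ltW.
transitivity (\int[lebesgue_measure]_r \int[mu]_t h (r, t))%E.
  apply: eq_integral => r _.
  have [r0|r0] := leP r 0.
    by rewrite !integral0_eq// => t _; rewrite /g /h /w/= ltNge r0/= mul0e.
  have mgr := measurable_fun_pair2 r mg.
  have r'0 : r != 0 by rewrite gt_eqF.
  rewrite (lebesgue_tuple_scale r'0 mgr)//.
  have msr := measurableT_comp mgr (@measurable_scale_tuple R n r).
  rewrite -(ge0_integralZl _ measurableT msr)//; last by move=> t _; exact: g0.
  apply: eq_integral => t _; rewrite /g /h /w/= r0/=.
  rewrite tuple_norm_scale ?(ltW r0)// muleA -EFinM; congr (_%:E * _)%E.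
  rewrite ler_pMr// (mulrC 2) ler_pM2l//.
  by case: ifP; rewrite ?mulr0// gtr0_norm.
transitivity (\int[mu]_t \int[lebesgue_measure]_r h (r, t))%E.
  exact: (fubini_tonelli h mh h0).
rewrite [RHS]integral_mkcond; apply: eq_integral => t _.
have [tS|tS] := boolP (1 <= tuple_norm t <= 2); last first.
  rewrite patchE memNset; last exact/negP.
  by rewrite integral0_eq// => r _; rewrite /h/= (negbTE tS) andbF mul0e.
rewrite patchE mem_set// [RHS]integral_mkcond; apply: eq_integral => r _.
rewrite /h/= tS andbT patchE; case: ifPn => r0.
  by rewrite mem_set/= ?in_itv/= ?r0// muleC powR_inv1// ltW.
by rewrite memNset/= ?in_itv/= ?andbT ?(negbTE r0)// mul0e.
Qed.

End polar.

(** * Combinations of torsion functions of balls *)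

Section dot.
Context (R : realType) (n : nat).
Implicit Types (x y : 'rV[R]_n) (r : R).

Lemma sqr_normD_dot x y : dot (x + y) (x + y) = dot x x + 2 * dot x y + dot y y.
Proof.
rewrite /dot mulr_sumr -!big_split/=; apply: eq_bigr => i _; rewrite !mxE; ring.
Qed.

Lemma dotZr r x y : dot x (r *: y) = r * dot x y.
Proof. by rewrite /dot mulr_sumr; apply: eq_bigr => i _; rewrite !mxE; ring. Qed.

Lemma dotNN x : dot (- x) (- x) = dot x x.
Proof. by rewrite -scaleN1r dotZ sqrrN expr1n mul1r. Qed.

Lemma dot_le x y : `|dot x y| <= (dot x x + dot y y) / 2.
Proof.
rewrite ler_norml; apply/andP; split.
  by have := dot_ge0 (x + y); rewrite sqr_normD_dot; lra.
have := dot_ge0 (x + (- y)); rewrite sqr_normD_dot dotNN -scaleN1r dotZr; lra.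
Qed.

End dot.

Lemma measurable_shell (R : realType) (n : nat) : measurable (@shell R n).
Proof.
rewrite (_ : @shell R n = setT `&` @tuple_norm R n @^-1` `[1, 2]%classic).
  exact: (measurable_tuple_norm measurableT (measurable_itv _)).
by rewrite setTI; apply/seteqP; split=> t /=; rewrite in_itv.
Qed.

Lemma tnth_le_tuple_norm (R : realType) (n : nat)
    (t : n.-tuple (measurableTypeR R)) (i : 'I_n) :
  `|tnth t i : R| <= tuple_norm t.
Proof.
rewrite -sqrtr_sqr ler_wsqrtr// /dot (bigD1 i)//= !mxE -expr2 lerDl.
by apply: sumr_ge0 => j _; rewrite -expr2 sqr_ge0.
Qed.

Lemma finite_measure_shell (R : realType) (n : nat) :
  (lebesgue_tuple R n (@shell R n) < +oo)%E.
Proof.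
(* The shell lies in the cube [-2, 2]^n, of measure 4^n. *)
pose I (i : 'I_n) : set (measurableTypeR R) := `[-2, 2]%classic.
have mI i : measurable (I i) by exact: measurable_itv.
pose Q := [set t : n.-tuple (measurableTypeR R) | forall i, I i (tnth t i)].
have mQ : measurable Q.
  rewrite (_ : Q = \bigcap_(i in [set: 'I_n])
     ((fun t : n.-tuple (measurableTypeR R) => tnth t i) @^-1` I i)).
    apply: fin_bigcap_measurable => // i _.
    by rewrite -[X in measurable X]setTI; apply: measurable_tnth.
  by apply/seteqP; split=> [t At i _|t At i]; exact: At.
apply: (@le_lt_trans _ _ (lebesgue_tuple R n Q)).
  apply: le_measure; rewrite ?inE//; first exact: measurable_shell.
  move=> t /andP[_ t2] i; rewrite /I/= in_itv/= -ler_norml.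
  exact: le_trans (tnth_le_tuple_norm _ _) t2.
rewrite lebesgue_tuple_box// /I; set l := lebesgue_measure _.
have -> : l = 4%:E.
  by rewrite /l lebesgue_measure_itv/= lte_fin -EFinB ifT; [congr (_%:E); ring|lra].
by rewrite prodEFin ltry.
Qed.

Section ball_combination.
Context (R : realType) (n m : nat) (s : R) (A : 'I_m -> R) (x0 : 'rV[R]_n).
Local Notation T := (n.-tuple (measurableTypeR R)).
Local Notation mu := (lebesgue_tuple R n).
Implicit Types (lam : 'I_m -> R) (x y : 'rV[R]_n).

Definition ball_combination lam y : R :=
  \sum_(i < m) lam i * pospow s (A i - dot (y - x0) (y - x0)).

Lemma ball_combinationN lam y :
  ball_combination (fun i => - lam i) y = - ball_combination lam y.
Proof.
rewrite /ball_combination; under eq_bigr do rewrite mulNr; exact: sumrN.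
Qed.

Definition ball_combination_bound lam : R := \sum_(i < m) `|lam i| * A i `^ s.

Lemma ball_combination_le lam y : 0 < s -> (forall i, 0 <= A i) ->
  `|ball_combination lam y| <= ball_combination_bound lam.
Proof.
move=> s0 A0; apply: (le_trans (ler_norm_sum _ _ _)); apply: ler_sum => i _.
rewrite normrM ler_wpM2l// ger0_norm ?pospow_ge0// /pospow.
apply: ge0_ler_powR; rewrite ?nnegrE ?(ltW s0)// ?le_max ?lexx ?orbT//.
by rewrite ge_max A0 andbT lerBlDr lerDl dot_ge0.
Qed.

Lemma ball_combination_shift lam x y : ball_combination lam (x + y) =
  \sum_(i < m) lam i * pospow s (A i - dot (x - x0) (x - x0) - 2 * dot (x - x0) y - dot y y).
Proof.
rewrite /ball_combination; apply: eq_bigr => i _; congr (_ * pospow _ _).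
by rewrite (_ : x + y - x0 = x - x0 + y) ?sqr_normD_dot; [ring|rewrite addrAC].
Qed.

Lemma measurable_ball_combination lam x : 0 < s ->
  measurable_fun setT (fun t : T => ball_combination lam (x + rV_of_tuple t)).
Proof.
move=> s0; apply: measurable_sum => i; apply: measurable_funM => //.
apply: (measurableT_comp (continuous_measurable_fun (pospow_continuous s0))).
apply: measurable_funB => //; apply: measurable_sum => j.
have mj : measurable_fun setT (fun t : T => (x + rV_of_tuple t - x0) 0 j).
  apply: (eq_measurable_fun (fun t : T => x 0 j - x0 0 j + rV_of_tuple t 0 j)).
    by move=> t _; rewrite !mxE; ring.
  by apply: measurable_funD => //; exact: measurable_rV_coord.
exact: measurable_funM.
Qed.

(** * Truncated kernels, their symmetrization, and their integrals along rays *)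

Section truncated.
Context (x : 'rV[R]_n) (e M : R).
Hypotheses (s0 : 0 < s) (s1 : s < 1) (e0 : 0 < e).

(* With M a bound of the combination, the term 2 * M makes the kernel nonnegative,
   so that Tonelli applies; it is the same for lam and - lam. *)
Definition truncated_kernel lam (t : T) : R :=
  if e <= tuple_norm t then
    (2 * M + (ball_combination lam x - ball_combination lam (x + rV_of_tuple t)))
      / tuple_norm t `^ (n%:R + 2 * s)
  else 0.

Lemma measurable_truncated_kernel lam : measurable_fun setT (truncated_kernel lam).
Proof.
have mN := @measurable_tuple_norm R n.
apply: measurable_fun_ifT => //; first exact: measurable_fun_ler.
apply: measurable_funM.
  apply: measurable_funD => //; apply: measurable_funB => //.
  exact: measurable_ball_combination.
apply: (eq_measurable_fun (fun t : T => tuple_norm t `^ (- (n%:R + 2 * s)))).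
  by move=> t _; rewrite powRN.
exact: (measurableT_comp (measurable_powR _) mN).
Qed.

Lemma truncated_kernel_ge0 lam t :
  (forall y, `|ball_combination lam y| <= M) -> 0 <= truncated_kernel lam t.
Proof.
move=> uM; rewrite /truncated_kernel; case: ifPn => // _.
rewrite divr_ge0 ?powR_ge0//.
have := uM x; have := uM (x + rV_of_tuple t).
set a := ball_combination _ _; set b := ball_combination _ _.
by rewrite !ler_norml => /andP[h1 h2] /andP[h3 h4]; lra.
Qed.

(** Pairing y with -y puts the contributions of b and -b on one ray, as the cancellation in
    [line_integral] requires. *)
Definition symmetric_kernel lam (t : T) : R :=
  truncated_kernel lam t + truncated_kernel lam (scale_tuple (-1) t).

Lemma symmetric_kernelE lam t : symmetric_kernel lam t =
  if e <= tuple_norm t then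
    (4 * M + (2 * ball_combination lam x - (ball_combination lam (x + rV_of_tuple t)
       + ball_combination lam (x - rV_of_tuple t))))
      / tuple_norm t `^ (n%:R + 2 * s)
  else 0.
Proof.
rewrite /symmetric_kernel /truncated_kernel.
have -> : tuple_norm (scale_tuple (-1) t) = tuple_norm t.
  by rewrite /tuple_norm rV_of_scale_tuple enormZ normrN1 mul1r.
rewrite (rV_of_scale_tuple (-1) t).
rewrite scaleN1r.
case: (e <= tuple_norm t); last exact: addr0.
set d := _ `^ _.
rewrite -mulrDl.
congr (_ * _).
set a := ball_combination _ x; set b := ball_combination _ _; set c := ball_combination _ _.
ring.
Qed.

Lemma integral_symmetric_kernel lam : (forall y, `|ball_combination lam y| <= M) ->
  (\int[mu]_t (symmetric_kernel lam t)%:E =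
   2%:E * \int[mu]_t (truncated_kernel lam t)%:E)%E.
Proof.
move=> uM.
have mk : measurable_fun setT (fun t => (truncated_kernel lam t)%:E).
  by apply/measurable_EFinP; exact: measurable_truncated_kernel.
have mks : measurable_fun setT
    (fun t => (truncated_kernel lam (scale_tuple (-1) t))%:E).
  exact: (measurableT_comp mk (@measurable_scale_tuple R n (-1))).
have k0 t : (0 <= (truncated_kernel lam t)%:E)%E.
  by rewrite lee_fin; exact: truncated_kernel_ge0.
have N1 : (-1 : R) != 0 by rewrite oppr_eq0 oner_eq0.
have := @lebesgue_tuple_scale R n (-1) _ N1 mk k0.
rewrite normrN1 expr1n mul1e => E.
transitivity (\int[mu]_t ((truncated_kernel lam t)%:E
    + (truncated_kernel lam (scale_tuple (-1) t))%:E))%E.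
  by apply: eq_integral => t _; rewrite -EFinD.
rewrite (ge0_integralD mu measurableT (fun t _ => k0 t) mk (fun t _ => k0 _) mks).
have aux (a b : \bar R) : a = b -> (a + b = 2%:E * a)%E.
  by move=> ->; rewrite -mule2n mule_natl.
exact: aux E.
Qed.

(** The inner integral of the polar formula; [t] runs over the shell and need not be a unit
    vector. *)
Definition ray_integral lam (t : T) : \bar R :=
  (\int[lebesgue_measure]_(r in `]0%R, +oo[)
    ((symmetric_kernel lam (scale_tuple r t))%:E * (r ^+ n / r)%:E))%E.

Lemma measurable_symmetric_kernel lam : measurable_fun setT (symmetric_kernel lam).
Proof.
have mk := measurable_truncated_kernel lam.
apply: measurable_funD; first exact: mk.
exact: (measurableT_comp mk (@measurable_scale_tuple R n (-1))).
Qed.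

Lemma symmetric_kernel_ge0 lam t :
  (forall y, `|ball_combination lam y| <= M) -> 0 <= symmetric_kernel lam t.
Proof. by move=> uM; rewrite addr_ge0// truncated_kernel_ge0. Qed.

Lemma ray_integral_ge0 lam t :
  (forall y, `|ball_combination lam y| <= M) -> (0 <= ray_integral lam t)%E.
Proof.
move=> uM; apply: integral_ge0 => r; rewrite /= in_itv/= andbT => r0.
by rewrite mule_ge0// lee_fin ?symmetric_kernel_ge0// divr_ge0 ?exprn_ge0// ltW.
Qed.

Lemma measurable_ray_integral lam :
  (forall y, `|ball_combination lam y| <= M) -> measurable_fun setT (ray_integral lam).
Proof.
move=> uM.
(* The integrand is extended by 0 to all real r, so that measurability follows from Tonelli on the
   full product. *)
pose h (p : T * measurableTypeR R) : \bar R :=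
  ((if 0 < p.2 then symmetric_kernel lam (scale_tuple p.2 p.1) *
     (p.2 ^+ n * p.2 `^ (-1)) else 0)%:E).
have m2 := measurable_snd (T1 := T) (T2 := measurableTypeR R).
have m1 := measurable_fst (T1 := T) (T2 := measurableTypeR R).
have mh : measurable_fun setT h.
  apply/measurable_EFinP; apply: measurable_fun_ifT => //.
    by apply: measurable_fun_ltr.
  apply: measurable_funM.
    apply: (measurableT_comp (measurable_symmetric_kernel lam)).
    exact: (measurableT_comp (@measurable_scale_tuple2 R n) (measurable_fun_pair m2 m1)).
  apply: measurable_funM; first exact: measurable_funX.
  exact: (measurableT_comp (measurable_powR (-1)) m2).
have h0 p : (0 <= h p)%E.
  rewrite lee_fin; case: ifPn => // p0.
  by rewrite mulr_ge0 ?symmetric_kernel_ge0// mulr_ge0 ?powR_ge0// exprn_ge0// ltW.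
apply: (eq_measurable_fun (fun t => \int[lebesgue_measure]_r h (t, r))%E).
  move=> t _; rewrite /ray_integral [RHS]integral_mkcond; apply: eq_integral => r _.
  rewrite /h/= patchE; case: ifPn => r0.
    by rewrite mem_set/= ?in_itv/= ?r0// EFinM powR_inv1// ltW.
  by rewrite memNset/= ?in_itv/= ?andbT ?(negbTE r0).
exact: (measurable_fun_fubini_tonelli_F h mh h0).
Qed.

Lemma polar_symmetric_kernel lam : (forall y, `|ball_combination lam y| <= M) ->
  ((ln 2)%:E * (2%:E * \int[mu]_t (truncated_kernel lam t)%:E) =
   \int[mu]_(t in @shell R n) ray_integral lam t)%E.
Proof.
move=> uM; rewrite -integral_symmetric_kernel//.
apply: polar_coordinates.
- by apply/measurable_EFinP; exact: measurable_symmetric_kernel.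
- by move=> t; rewrite lee_fin; exact: symmetric_kernel_ge0.
- by move=> t t0; rewrite symmetric_kernelE t0 leNgt e0 /=.
Qed.

End truncated.

End ball_combination.

(** On the ray x + r y the quantity A_i - |x + r y - x0|^2 equals a_i + 2 b r - c r^2, with a_i =
    A_i - |x - x0|^2, b = - <x - x0, y> and c = |y|^2. The cut-off |r y| >= e means r >= e / |y|, so
    [line_integral] applies with T = |y| / e. The main term depends on [M] but not otherwise on
    [lam], and [K], [B] are uniform in [e], [M] and [t]. *)
Lemma ray_integralE (R : realType) (n m : nat) (s : R) (A : 'I_m -> R)
    (x0 : 'rV[R]_n) (lam : 'I_m -> R) (x : 'rV[R]_n) : 0 < s -> s < 1 -> \sum_(i < m) lam i = 0 ->
  (forall i, 1 <= A i - dot (x - x0) (x - x0)) ->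
  exists K B : R, [/\ 0 <= B, 0 <= K & forall (e M : R) (t : n.-tuple (measurableTypeR R)), 0 < e ->
    8 * (B + 1) * e <= 1 -> @shell R n t ->
    (forall y, `|ball_combination s A x0 lam y| <= M) ->
    exists2 E, `|E| <= K * (e ^+ 2) `^ (1 - s) &
    ray_integral s A x0 x e M lam t = (tuple_norm t `^ (- (n%:R + 2 * s)) *
       (4 * M * ((tuple_norm t / e) ^+ 2) `^ s / (2 * s) + E))%:E].
Proof.
move=> s0 s1 lam0 A1.
(* [B] bounds |<xi, y>| <= (|xi|^2 + |y|^2) / 2, as |y| <= 2 on the shell. *)
pose xi := x - x0; pose B := (dot xi xi + 4) / 2.
have B0 : 0 <= B by have := dot_ge0 xi; rewrite /B; lra.
pose a i := A i - dot xi xi.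
have [K KP] := line_integral s0 s1 lam0 (A1 : forall i, 1 <= a i) B0.
exists `|K|, B; split => // e M t e0 eB tS uM.
set N := tuple_norm t.
have /andP[N1 N2] : 1 <= N <= 2 by exact: tS.
have N0 : 0 < N by lra.
pose y := rV_of_tuple t.
pose b := - dot xi y.
pose c := dot y y.
have cN : c = N ^+ 2 by rewrite /N /tuple_norm sqr_enorm.
have cI : 1 <= c <= 4 by rewrite cN; apply/andP; split; nra.
have /andP[c1 c4] := cI.
have bB : `|b| <= B.
  by rewrite normrN; apply: (le_trans (dot_le _ _)); rewrite /B -/c; lra.
have TB : 8 * (B + 1) <= N / e.
  by rewrite ler_pdivlMr//; apply: (le_trans eB).
have uE r : ball_combination s A x0 lam (x + r *: y) =
   \sum_(i < m) lam i * pospow s (a i + 2 * b * r - c * r ^+ 2).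
  rewrite ball_combination_shift; apply: eq_bigr => i _; congr (_ * pospow _ _).
  by rewrite dotZr dotZ /a /b /c; ring.
have ux : ball_combination s A x0 lam x = \sum_(i < m) lam i * a i `^ s.
  rewrite -[x in LHS]addr0 -(scale0r y) uE; apply: eq_bigr => i _.
  rewrite expr0n/= !mulr0 addr0 subr0 pospowE//.
  by have := A1 i; rewrite -/xi -/(a i); lra.
have uNE r : ball_combination s A x0 lam (x - r *: y) =
   \sum_(i < m) lam i * pospow s (a i + 2 * (- b) * r - c * r ^+ 2).
  rewrite -scaleNr uE; apply: eq_bigr => i _; congr (_ * pospow _ _); ring.
pose D r := 2 * (\sum_(i < m) lam i * a i `^ s)
    - \sum_(i < m) lam i * (pospow s (a i + 2 * b * r - c * r ^+ 2) +
                             pospow s (a i + 2 * (- b) * r - c * r ^+ 2)).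
have DE r : D r = 2 * ball_combination s A x0 lam x - (ball_combination s A x0 lam (x + r *: y)
    + ball_combination s A x0 lam (x - r *: y)).
  rewrite uE uNE ux /D -big_split/=; congr (_ - _).
  by apply: eq_bigr => i _; rewrite mulrDr.
have D0 r : 0 < r -> 0 <= 4 * M + D r.
  have aux (u1 u2 u3 : R) : `|u1| <= M -> `|u2| <= M -> `|u3| <= M ->
      0 <= 4 * M + (2 * u1 - (u2 + u3)).
    by rewrite !ler_norml => /andP[h1 h2] /andP[h3 h4] /andP[h5 h6]; lra.
  by move=> _; rewrite DE; exact: aux.
have [E E1 E2] := KP b c (N / e) (4 * M) bB cI TB D0.
exists E.
  apply: (le_trans E1); apply: (@le_trans _ _ (`|K| * ((N / e) ^+ 2) `^ (s - 1))).
    by rewrite ler_wpM2r ?powR_ge0// ler_norm.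
  rewrite ler_wpM2l//.
  have -> : (e ^+ 2) `^ (1 - s) = ((e ^+ 2)^-1) `^ (s - 1).
    by rewrite -powR_inv1 ?sqr_ge0// -powRrM; congr (_ `^ _); ring.
  apply: le_powR_neg; rewrite ?invr_gt0 ?exprn_gt0//; last lra.
  by rewrite exprMn exprVn ler_peMl ?invr_ge0 ?sqr_ge0// exprn_ege1.
have p0 : 0 <= N `^ (- (n%:R + 2 * s)) by exact: powR_ge0.
have mD : measurable_fun setT (fun r : measurableTypeR R => (4 * M + D r) / r `^ (1 + 2 * s)).
  have mq b' i : measurable_fun setT (fun r : measurableTypeR R =>
      pospow s (a i + 2 * b' * r - c * r ^+ 2)).
    apply: (measurableT_comp (continuous_measurable_fun (pospow_continuous s0))).
    apply: measurable_funB; last by apply: measurable_funM.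
    by apply: measurable_funD => //; apply: measurable_funM.
  apply: measurable_funM; last first.
    apply: (eq_measurable_fun (fun r : measurableTypeR R => r `^ (- (1 + 2 * s)))).
      by move=> r _; rewrite powRN.
    exact: measurable_powR.
  apply: measurable_funD => //; apply: measurable_funB => //.
  apply: measurable_sum => i; apply: measurable_funM => //.
  by apply: measurable_funD; exact: mq.
have Te : (N / e)^-1 = e / N by rewrite invf_div.
have mDi : measurable_fun `[(N / e)^-1, +oo[
    (fun r : measurableTypeR R => ((4 * M + D r) / r `^ (1 + 2 * s))%:E).
  by apply: measurable_funTS; apply/measurable_EFinP.
have D0i (r : measurableTypeR R) : `[(N / e)^-1, +oo[%classic r ->
    (0 <= ((4 * M + D r) / r `^ (1 + 2 * s))%:E)%E.
  rewrite /= in_itv/= andbT Te => er; rewrite lee_fin divr_ge0 ?powR_ge0//.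
  by apply: D0; apply: lt_le_trans er; rewrite divr_gt0.
have mI : measurable (`[(N / e)^-1, +oo[%classic : set (measurableTypeR R)).
  exact: measurable_itv.
rewrite EFinM -E2 -(ge0_integralZl lebesgue_measure mI mDi D0i)//.
rewrite /ray_integral [LHS]integral_mkcond [RHS]integral_mkcond; apply: eq_integral => r _.
rewrite !patchE; have [er|er] := leP (e / N) r; last first.
  rewrite [in RHS]memNset; last by rewrite /= in_itv/= andbT Te leNgt er.
  case: ifPn => //; rewrite inE/= in_itv/= andbT => r0.
  rewrite symmetric_kernelE tuple_norm_scale ?(ltW r0)//.
  rewrite ltr_pdivlMr// in er.
  by rewrite leNgt er/= mul0e.
have r0 : 0 < r by apply: lt_le_trans er; rewrite divr_gt0.
rewrite !mem_set; [|by rewrite /= in_itv/= andbT Te|by rewrite /= in_itv/= r0].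
rewrite symmetric_kernelE tuple_norm_scale ?(ltW r0)//.
rewrite -ler_pdivrMr// er rV_of_scale_tuple -/y -DE -!EFinM; congr (_%:E).
rewrite powRM ?(ltW r0) ?(ltW N0)// powRN.
have r'0 : r != 0 by rewrite gt_eqF.
rewrite !(@powRD _ r) ?r'0 ?implybT// powRr1 ?(ltW r0)// powR_mulrn ?(ltW r0)//.
have w0 : r `^ (2 * s) != 0 by rewrite gt_eqF// powR_gt0.
have v0 : N `^ (n%:R + 2 * s) != 0 by rewrite gt_eqF// powR_gt0.
have z0 : r ^+ n != 0 by rewrite expf_neq0.
move: w0 v0 z0; move: (r `^ _) (N `^ _) (r ^+ n) (4 * M + D r) => w v z d w0 v0 z0.
by field; rewrite w0 v0 z0 r'0.
Qed.

(** * Comparison of the truncated integrals for opposite coefficients, and the limit of the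
    truncated fractional Laplacian *)

Section ball_combination_limit.
Context (R : realType) (n m : nat) (s : R) (A : 'I_m -> R) (x0 x : 'rV[R]_n).
Local Notation T := (n.-tuple (measurableTypeR R)).
Local Notation mu := (lebesgue_tuple R n).
Local Notation u := (ball_combination s A x0).
Hypotheses (s0 : 0 < s) (s1 : s < 1) (A1 : forall i, 1 <= A i - dot (x - x0) (x - x0)).

Let A0 i : 0 <= A i.
Proof. by have := A1 i; have := dot_ge0 (x - x0); lra. Qed.

Let I lam e := (\int[mu]_t (truncated_kernel s A x0 x e
   (ball_combination_bound s A lam) lam t)%:E)%E.

(* The truncated fractional Laplacian is half the difference of the integrals for
   lam and - lam. *)
Lemma truncated_kernel_compare lam : \sum_(i < m) lam i = 0 ->
  exists K d : R, [/\ 0 < d, 0 <= K & forall e, 0 < e -> e <= d ->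
    ((ln 2)%:E * (2%:E * I lam e) <=
      (ln 2)%:E * (2%:E * I (fun i => - lam i)%R e) + (K * (e ^+ 2) `^ (1 - s))%:E)%E
    /\ (I lam e < +oo)%E].
Proof.
pose lamN i := - lam i; rewrite -/lamN => lam0.
have lam0' : \sum_(i < m) lamN i = 0 by rewrite sumrN lam0 oppr0.
have [K1 [B1 [B10 K10 H1]]] := ray_integralE s0 s1 lam0 A1.
have [K2 [B2 [B20 K20 H2]]] := ray_integralE s0 s1 lam0' A1.
have [S0 Sfin] : (0 <= mu (@shell R n))%E /\ mu (@shell R n) \is a fin_num.
  by split=> //; rewrite ge0_fin_numE ?finite_measure_shell.
pose V := fine (mu (@shell R n)).
have V0 : 0 <= V by exact: fine_ge0.
have mS := @measurable_shell R n.
have IC (C : R) : (\int[mu]_(t in @shell R n) cst C%:E t = (C * V)%:E)%E.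
  rewrite (integral_cst mu mS) EFinM; congr (_ * _)%E; exact/esym/fineK.
(* Small enough for [ray_integralE] to apply to both [lam] and [lamN] whenever [e <= d]. *)
pose d := (8 * (B1 + B2 + 1))^-1.
have d0 : 0 < d by rewrite invr_gt0; lra.
exists ((K1 + K2) * V), d; split => //; first by rewrite mulr_ge0// addr_ge0.
move=> e e0 ed.
have eB : 8 * (B1 + B2 + 1) * e <= 1.
  by rewrite mulrC -ler_pdivlMr ?div1r//; lra.
have eB1 : 8 * (B1 + 1) * e <= 1 by apply: le_trans eB; rewrite ler_wpM2r ?(ltW e0)//; lra.
have eB2 : 8 * (B2 + 1) * e <= 1 by apply: le_trans eB; rewrite ler_wpM2r ?(ltW e0)//; lra.
pose M := ball_combination_bound s A lam.
have ME : ball_combination_bound s A lamN = M.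
  by apply: eq_bigr => i _; rewrite normrN.
have uM y : `|u lam y| <= M by exact: ball_combination_le.
have uM' y : `|u lamN y| <= M.
  by rewrite ball_combinationN normrN; exact: uM.
rewrite /I ME -/M.
have P1 := polar_symmetric_kernel x s0 e0 uM.
have P2 := polar_symmetric_kernel x s0 e0 uM'.
rewrite P1 P2.
pose eta := (e ^+ 2) `^ (1 - s).
have eta0 : 0 <= eta by exact: powR_ge0.
have w1 (t : T) : @shell R n t -> 0 <= tuple_norm t `^ (- (n%:R + 2 * s)) <= 1.
  move=> /andP[t1 _]; rewrite powR_ge0/= powRN invf_le1 ?powR_gt0//; last lra.
  rewrite -[leLHS](powRr0 (tuple_norm t)); apply: ler_powR => //.
  by rewrite addr_ge0 ?ler0n ?mulr_ge0 ?(ltW s0).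
have r1 t : (0 <= ray_integral s A x0 x e M lam t)%E by exact: ray_integral_ge0.
have r2 t : (0 <= ray_integral s A x0 x e M lamN t)%E.
  exact: ray_integral_ge0.
have mr1 := measurable_ray_integral x e s0 uM.
have mr2 := measurable_ray_integral x e s0 uM'.
split.
  (* The main terms for [lam] and [lamN] coincide since both use the same [M]; only the two errors
     differ, and the weight |t|^(-(n+2s)) is at most 1 on the shell. *)
  apply: (@le_trans _ _ (\int[mu]_(t in @shell R n)
     (ray_integral s A x0 x e M lamN t + cst ((K1 + K2) * eta)%:E t))%E).
    apply: ge0_le_integral => //.
    - exact: measurable_funTS.
    - apply: emeasurable_funD => //; exact: measurable_funTS.
    - move=> t St.
      have [E1 h1 ->] := H1 e M t e0 eB1 St uM.
      have [E2 h2 ->] := H2 e M t e0 eB2 St uM'.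
      rewrite /cst -EFinD lee_fin.
      have /andP[] := w1 t St; set w := _ `^ (- _) => w0 w1'.
      rewrite -lerBlDl -mulrBr opprD addrACA subrr add0r.
      apply: (@le_trans _ _ (w * ((K1 + K2) * eta))); last first.
        by rewrite ler_piMl// mulr_ge0// addr_ge0.
      rewrite ler_wpM2l// mulrDl.
      move: h1 h2; rewrite !ler_norml -/eta => /andP[_ h1] /andP[h2 _]; lra.
  have mr2S : measurable_fun (@shell R n) (ray_integral s A x0 x e M lamN).
    exact: measurable_funTS.
  have c0 (t : T) : @shell R n t -> (0 <= cst ((K1 + K2) * eta)%:E t)%E.
    by move=> _; rewrite lee_fin mulr_ge0// addr_ge0.
  rewrite (ge0_integralD mu mS (fun t _ => r2 t) mr2S c0 (measurable_cst _)).
  rewrite IC le_eqVlt; apply/orP; left; apply/eqP; congr (_ + _%:E)%E.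
  by rewrite /eta; ring.
(* For fixed [e] the ray integrals are bounded on the shell, which has finite measure; |t| <= 2
   gives the 2 / e in [C]. *)
have fin2 : (\int[mu]_(t in @shell R n) ray_integral s A x0 x e M lam t < +oo)%E.
  pose C := 4 * M * ((2 / e) ^+ 2) `^ s / (2 * s) + K1 * eta.
  apply: (@le_lt_trans _ _ (\int[mu]_(t in @shell R n) cst C%:E t)%E); last first.
    by rewrite IC ltry.
  have M0 : 0 <= M by apply: le_trans (uM 0).
  apply: ge0_le_integral => //.
  - exact: measurable_funTS.
  - move=> t St.
    have [E1 h1 ->] := H1 e M t e0 eB1 St uM.
    rewrite lee_fin; have /andP[] := w1 t St; set w := _ `^ (- _) => w0 w1'.
    have /andP[t1 t2] := St.
    have tC : 4 * M * ((tuple_norm t / e) ^+ 2) `^ s / (2 * s) + E1 <= C.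
      rewrite lerD//; last by move: h1; rewrite ler_norml => /andP[].
      rewrite ler_wpM2r ?invr_ge0 ?mulr_ge0 ?(ltW s0)// ler_wpM2l ?mulr_ge0//.
      apply: ge0_ler_powR; rewrite ?nnegrE ?sqr_ge0 ?(ltW s0)//.
      rewrite lerXn2r ?nnegrE ?divr_ge0 ?(ltW e0) ?tuple_norm_ge0//.
      by rewrite ler_wpM2r// invr_ge0 ltW.
    apply: (@le_trans _ _ (w * C)); first by rewrite ler_wpM2l.
    rewrite ler_piMl// /C addr_ge0 ?mulr_ge0 ?powR_ge0 ?invr_ge0 ?mulr_ge0 ?(ltW s0)//.
move: fin2; rewrite -P1; set J := (\int[mu]_t _)%E.
have J0 : (0 <= J)%E.
  by apply: integral_ge0 => t _; rewrite lee_fin; exact: truncated_kernel_ge0.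
have l2 : 0 < ln (2 : R) by rewrite ln_gt0// ltr1n.
case: J J0 => [j _ _|_|//]; first exact: ltry.
by rewrite !gt0_muley// lte_fin.
Qed.

End ball_combination_limit.

Section ball_combination_frac_laplacian.
Context (R : realType) (n m : nat) (s : R) (A : 'I_m -> R) (x0 x : 'rV[R]_n).
Local Notation T := (n.-tuple (measurableTypeR R)).
Local Notation mu := (lebesgue_tuple R n).
Local Notation u := (ball_combination s A x0).
Hypotheses (s0 : 0 < s) (s1 : s < 1) (A1 : forall i, 1 <= A i - dot (x - x0) (x - x0)).

Let D (e : R) := [set t : T | e <= enorm (rV_of_tuple t)].
Let K lam (t : T) := (frac_laplacian_kernel s (u lam) x (rV_of_tuple t))%:E.

Lemma measurable_enorm_ge (e : R) : measurable (D e).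
Proof.
rewrite (_ : D e = setT `&` @tuple_norm R n @^-1` `[e, +oo[%classic).
  exact: (measurable_tuple_norm measurableT (measurable_itv _)).
by rewrite setTI; apply/seteqP; split=> t /=; rewrite in_itv/= andbT.
Qed.

(** The one-sided comparison, used for [lam] and again for [- lam], becomes a two-sided bound. In 4
    ln 2, one factor 2 comes from taking half of the difference and 2 ln 2 from the polar identity
    for the symmetrized kernel. *)
Lemma truncated_frac_laplacian lam : \sum_(i < m) lam i = 0 ->
  exists d C : R, 0 < d /\ forall e, 0 < e -> e <= d ->
    mu.-integrable (D e) (K lam) /\
    exists2 j : R, `|j| <= C * (e ^+ 2) `^ (1 - s) &
      (\int[mu]_(t in D e) K lam t)%E = j%:E.
Proof.
move=> lam0; pose lamN i := - lam i.
have lamN0 : \sum_(i < m) lamN i = 0 by rewrite sumrN lam0 oppr0.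
have lamNN : (fun i => - lamN i) = lam by apply/funext => i; rewrite opprK.
have [C1 [d1 [d10 C10 H1]]] := truncated_kernel_compare s0 s1 A1 lam0.
have [C2 [d2 [d20 C20 H2]]] := truncated_kernel_compare s0 s1 A1 lamN0.
pose M := ball_combination_bound s A lam.
have ME : ball_combination_bound s A lamN = M.
  by apply: eq_bigr => i _; rewrite normrN.
have A0 i : 0 <= A i by have := A1 i; have := dot_ge0 (x - x0); lra.
have uM y : `|u lam y| <= M by exact: ball_combination_le.
have uNM y : `|u lamN y| <= M by rewrite ball_combinationN normrN; exact: uM.
have l2 : 0 < ln (2 : R) by rewrite ln_gt0// ltr1n.
rewrite -/lamN ME -/M in H1; rewrite lamNN ME -/M in H2.
exists (Num.min d1 d2), ((C1 + C2) / (4 * ln 2)); split; first by rewrite lt_min d10.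
move=> e e0; rewrite le_min => /andP[ed1 ed2].
have [h1 f1] := H1 e e0 ed1; have [h2 f2] := H2 e e0 ed2.
pose k1 := truncated_kernel s A x0 x e M lam.
pose k2 := truncated_kernel s A x0 x e M lamN.
have k10 t : 0 <= k1 t by exact: truncated_kernel_ge0.
have k20 t : 0 <= k2 t by exact: truncated_kernel_ge0.
have ik (k : T -> R) : measurable_fun setT k -> (forall t, 0 <= k t) ->
    (\int[mu]_t (k t)%:E < +oo)%E -> mu.-integrable setT (fun t => (k t)%:E).
  move=> mk k0 kf; apply/integrableP; split; first exact/measurable_EFinP.
  by under eq_integral do rewrite gee0_abs ?lee_fin//.
have i1 : mu.-integrable setT (fun t => (k1 t)%:E).
  by apply: ik => //; exact: measurable_truncated_kernel.
have i2 : mu.-integrable setT (fun t => (k2 t)%:E).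
  by apply: ik => //; exact: measurable_truncated_kernel.
pose j1 := fine (\int[mu]_t (k1 t)%:E)%E.
pose j2 := fine (\int[mu]_t (k2 t)%:E)%E.
have J1 : (\int[mu]_t (k1 t)%:E = j1%:E)%E.
  by rewrite fineK// ge0_fin_numE//; apply: integral_ge0 => t _; rewrite lee_fin.
have J2 : (\int[mu]_t (k2 t)%:E = j2%:E)%E.
  by rewrite fineK// ge0_fin_numE//; apply: integral_ge0 => t _; rewrite lee_fin.
(* The terms 2 M cancel in the difference, while the increments of the combination have opposite
   signs; half of the difference is the true kernel on [D e]. *)
pose k3 t := 2^-1 * (k1 t - k2 t).
have i3 : mu.-integrable setT (fun t => (k3 t)%:E).
  exact: (integrableZl measurableT (2^-1) (integrableB measurableT i1 i2)).
have KD : (K lam) \_ (D e) = (fun t => (k3 t)%:E).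
  apply/funext => t; rewrite patchE /k3 /k1 /k2 /truncated_kernel.
  rewrite !ball_combinationN /K /frac_laplacian_kernel.
  have [tD|tD] := boolP (e <= tuple_norm t).
    rewrite mem_set; last exact: tD.
    congr (_%:E); rewrite -/(tuple_norm t).
    move: (u lam x) (u lam _) (_^-1) => a b w; by field.
  by rewrite memNset ?subrr ?mulr0//; exact/negP.
split; first by apply/(integrable_mkcond _ (measurable_enorm_ge e)); rewrite KD.
exists (2^-1 * (j1 - j2)); last first.
  rewrite integral_mkcond KD.
  transitivity ((2^-1)%:E * \int[mu]_t ((k1 t)%:E - (k2 t)%:E))%E.
    exact: (integralZl measurableT (integrableB measurableT i1 i2)).
  by rewrite integralB_EFin// J1 J2.
move: h1 h2; rewrite -/k1 -/k2 J1 J2 -!EFinM -!EFinD !lee_fin.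
set eta := _ `^ _ => h1 h2.
have -> : (C1 + C2) / (4 * ln 2) * eta = ((C1 + C2) * eta) / (4 * ln 2) by ring.
rewrite ler_pdivlMr; last by rewrite mulr_gt0.
rewrite -[X in _ * X]gtr0_norm ?mulr_gt0// -normrM.
have -> : 2^-1 * (j1 - j2) * (4 * ln 2) = ln 2 * (2 * j1) - ln 2 * (2 * j2) by field.
have eta0 : 0 <= eta by exact: powR_ge0.
have e1 : 0 <= C1 * eta by rewrite mulr_ge0.
have e2 : 0 <= C2 * eta by rewrite mulr_ge0.
by rewrite ler_norml mulrDl; apply/andP; split; lra.
Qed.

Lemma ball_combination_frac_laplacian lam : \sum_(i < m) lam i = 0 ->
  is_frac_laplacian s (u lam) x 0.
Proof.
move=> lam0; have [d [C [d0 H]]] := truncated_frac_laplacian lam0.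
split => [e e0|].
  (* For e > d integrability is inherited from the larger domain [D d]. *)
  pose e' := Num.min e d.
  have e'0 : 0 < e' by rewrite lt_min e0.
  have e'd : e' <= d by rewrite ge_min lexx orbT.
  have [iK _] := H e' e'0 e'd.
  apply: (integrableS (measurable_enorm_ge e') (measurable_enorm_ge e) _ iK).
  by move=> t /= et; apply: le_trans et; rewrite ge_min lexx.
have near_d : \forall e \near (0 : R)^'+, 0 < e /\ e <= d.
  near=> e; split; first by near: e; exact: nbhs_right_gt.
  by near: e; exact: nbhs_right_le.
apply: cvg_EFin.
  near=> e; have [e0 ed] : 0 < e /\ e <= d by near: e.
  by have [_ [j _ ->]] := H e e0 ed.
apply/norm_cvg0P.
(* The exponent 2 (1 - s) is positive because s < 1. *)
apply: (@squeeze_cvgr _ _ _ _ (cst 0) (fun e => C * e `^ (2 * (1 - s)))).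
- near=> e; have [e0 ed] : 0 < e /\ e <= d by near: e.
  have [_ [j jC jE]] := H e e0 ed.
  rewrite /cst/= normr_ge0/=.
  by rewrite jE/= powRrM powR_mulrn// ltW.
- exact: cvg_cst.
- rewrite -[X in _ --> X](mulr0 C); apply: cvgM; first exact: cvg_cst.
  by apply: powR_cvg0; rewrite mulr_gt0// subr_gt0.
Unshelve. all: by end_near. Qed.

End ball_combination_frac_laplacian.

(** * Combinations that are flat at the centre *)

Section flat_combination.
Context (R : realType).
Implicit Types (s t : R) (m : nat).

Definition flat_poly s m : {poly R} :=
  ('X - 1%:P) * \prod_(j < m) ('X - (2 `^ (s - j%:R))%:P).

Lemma flat_poly1 s m : (flat_poly s m).[1] = 0.
Proof. by rewrite /flat_poly hornerM hornerXsubC subrr mul0r. Qed.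

Lemma flat_poly_root s m j : (j < m)%N -> (flat_poly s m).[2 `^ (s - j%:R)] = 0.
Proof.
move=> jm; rewrite /flat_poly hornerM horner_prod (bigD1 (Ordinal jm))//=.
by rewrite !hornerXsubC subrr mul0r mulr0.
Qed.

Lemma powR2_inj s t : (2 : R) `^ s = 2 `^ t -> s = t.
Proof.
move=> /(congr1 (@ln R)); rewrite !ln_powR; apply: mulIf.
by rewrite gt_eqF// ln_gt0// ltr1n.
Qed.

Lemma subr_nat_neq0 s l : 0 < s -> s < 1 -> s - l%:R != 0.
Proof.
move=> s0 s1; case: l => [|l]; first by rewrite subr0 gt_eqF.
by rewrite subr_eq0 lt_eqF// (lt_le_trans s1)// ler1n.
Qed.

(** All roots are powers of 2, with exponents 0 and s - j for j < m. The exponent s - m differs from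
    these: s is not an integer, and m is not below itself. *)
Lemma flat_poly_neq0 s m : 0 < s -> s < 1 -> (flat_poly s m).[2 `^ (s - m%:R)] != 0.
Proof.
move=> s0 s1; rewrite /flat_poly hornerM horner_prod mulf_neq0//.
  rewrite hornerXsubC subr_eq0; apply/eqP => h.
  have /powR2_inj/eqP : (2 : R) `^ (s - m%:R) = 2 `^ 0 by rewrite powRr0.
  by apply/negP; exact: subr_nat_neq0.
apply/prodf_neq0 => j _; rewrite hornerXsubC subr_eq0.
apply/eqP => /powR2_inj/addrI/oppr_inj/eqP; rewrite eqr_nat => /eqP jm.
by have := ltn_ord j; rewrite -jm ltnn.
Qed.

(** A squared radius. As |x - x0|^2 < 4 in B_1, the factor 5 leaves a margin of 1 in every ball; the
    ratio 2 makes derivatives at 0 values of [flat_poly] at powers of 2. *)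
Definition flat_radius (i : nat) : R := 5 * 2 ^+ i.

Lemma flat_radius_ge5 i : 5 <= flat_radius i.
Proof. by rewrite /flat_radius ler_peMr// exprn_ege1// ler1n. Qed.

(* Up to a nonzero factor, the l-th derivative of the profile flat_sum s m 0. *)
Definition flat_sum s m l t : R :=
  \sum_(i < size (flat_poly s m)) (flat_poly s m)`_i *
    (flat_radius i - t) `^ (s - l%:R).

Lemma flat_sum0 s m l :
  flat_sum s m l 0 = 5 `^ (s - l%:R) * (flat_poly s m).[2 `^ (s - l%:R)].
Proof.
rewrite horner_coef mulr_sumr; apply: eq_bigr => i _; rewrite subr0.
rewrite /flat_radius powRM// -(powR_mulrn i)// -powRrM (mulrC i%:R) powRrM.
by rewrite powR_mulrn ?powR_ge0//; ring.
Qed.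

Lemma is_derive_flat_sum s m l t : t < 5 ->
  is_derive t 1 (flat_sum s m l) (- (s - l%:R) * flat_sum s m l.+1 t).
Proof.
move=> t5; rewrite /flat_sum mulr_sumr; apply: is_derive_sumf => i.
have p0 : 0 < flat_radius i - t.
  by rewrite subr_gt0; apply: lt_le_trans (flat_radius_ge5 i).
have d1 := is_derive1_powR (s - l%:R) p0.
have d2 : is_derive t 1 (fun t => flat_radius i - t) (-1).
  by apply: is_derive_eq; rewrite add0r mul1r.
have := @is_derive1_comp R (fun x => x `^ (s - l%:R)) (fun t => flat_radius i - t) t _ _ d1 d2; rewrite /comp => d3.
apply: is_derive_eq; rewrite /GRing.scale/=.
have -> : s - l.+1%:R = s - l%:R - 1 by rewrite -natr1; ring.
by ring.
Qed.

(** Induction from the m-th derivative, which is nonzero at 0, down to the profile itself. Each step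
    is L'Hopital's rule, valid because the lower derivatives vanish at 0; the new factor - (s - l) /
    (j + 1) is nonzero since s is not an integer. *)
Lemma flat_sum_order s m j : 0 < s -> s < 1 -> (j <= m)%N ->
  exists2 L : R, L != 0 & flat_sum s m (m - j) t / t ^+ j @[t --> 0^'+] --> L.
Proof.
move=> s0 s1; have cont l : {for 0, continuous (flat_sum s m l)}.
  apply/differentiable_continuous/derivable1_diffP.
  have t5 : (0 : R) < 5 by [].
  by have [] := is_derive_flat_sum s m l t5.
elim: j => [_|j IH jm].
  exists (flat_sum s m m 0).
    rewrite flat_sum0; apply: mulf_neq0; last exact: flat_poly_neq0.
    by rewrite gt_eqF// powR_gt0.
  rewrite subn0; under eq_fun do rewrite expr0 divr1.
  exact/cvg_at_right_filter/cont.
have [L L0 HL] := IH (ltnW jm).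
set l := (m - j.+1)%N.
have lE : (m - j)%N = l.+1 by rewrite /l subnSK.
exists (- (s - l%:R) / j.+1%:R * L).
  by rewrite !mulf_neq0// ?oppr_eq0 ?subr_nat_neq0// invr_eq0 pnatr_eq0.
apply: (@lhopital_at_right R (flat_sum s m l)
   (fun t => - (s - l%:R) * flat_sum s m l.+1 t)
   (fun t => t ^+ j.+1) (fun t => j.+1%:R * t ^+ j) 0 1).
- exact: ltr01.
- move=> t; rewrite in_itv/= => /andP[t0 t1]; apply: is_derive_flat_sum; lra.
- move=> t _; apply: DeriveDef; first exact: exprn_derivable.
  by rewrite exp_derive /GRing.scale/= mulr1.
- have F0 : flat_sum s m l 0 = 0.
    by rewrite flat_sum0 flat_poly_root ?mulr0// /l ltn_subrL /=; case: (m) jm.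
  by have := cvg_at_right_filter (cont l); rewrite F0.
- have := cvg_at_right_filter (@exprn_continuous R j.+1 0).
  by rewrite expr0n.
- move=> t; rewrite in_itv/= => /andP[t0 _].
  by rewrite mulf_neq0 ?pnatr_eq0// expf_neq0// gt_eqF.
have -> : (fun t => - (s - l%:R) * flat_sum s m l.+1 t / (j.+1%:R * t ^+ j)) =
    (fun t => - (s - l%:R) / j.+1%:R * (flat_sum s m (m - j) t / t ^+ j)).
  by apply/funext => t; rewrite lE invfM; ring.
by apply: cvgM; [exact: cvg_cst|exact: HL].
Qed.
End flat_combination.

(** * Smoothness *)

Lemma is_derive_lineP (R : realType) (V : normedModType R) (f : V -> R) (x v : V)
    (d : R) :
  is_derive (0 : R) (1 : R) (fun h : R => f (h *: v + x)) d -> is_derive x v f d.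
Proof.
move=> [df Df]; set phi := fun h : R => f (h *: v + x) in df Df.
have E : (fun h : R => h^-1 *: ((phi \o shift 0) (h *: 1) - phi 0)) =
         (fun h : R => h^-1 *: ((f \o shift x) (h *: v) - f x)).
  apply/funext => h; rewrite /phi /=.
  by rewrite addr0 scale0r add0r [h *: 1]mulr1.
split; first by move: df; rewrite /derivable E.
by rewrite -Df /derive E.
Qed.

(** A class of functions that are continuous on [U] and whose partial derivatives on [U] stay in the
    class consists of smooth functions. As [U] is open, agreement on [U] passes to all derivatives
    there. *)
Lemma smooth_on_closed_class (R : realType) (n : nat) (U : set 'rV[R]_n)
    (C : ('rV[R]_n -> R) -> Prop) : open U ->
  (forall f x, C f -> U x -> {for x, continuous f}) ->
  (forall f (j : 'I_n), C f -> exists2 g, C g &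
     forall x, U x -> is_derive x (delta_mx 0 j) f (g x)) ->
  forall f g, C g -> (forall x, U x -> f x = g x) -> smooth_on U f.
Proof.
move=> oU cC dC f f0 Cf0 ff0.
have near_eq (g h : 'rV[R]_n -> R) x : U x -> (forall y, U y -> g y = h y) ->
    \forall y \near x, g y = h y.
  move=> Ux gh; near=> y; apply: gh; near: y; exact: open_nbhs_nbhs.
have H js : exists2 g, C g & forall x, U x -> iter_partial js f x = g x.
  elim: js => [|j js [g Cg Hg]]; first by exists f0.
  have [h Ch Hh] := dC g j Cg; exists h => // x Ux /=.
  rewrite (near_eq_derive _ (near_eq _ _ _ Ux Hg)).
  by have [_ ->] := Hh x Ux.
move=> js x Ux; have [g Cg Hg] := H js.
have ngf : \forall y \near x, g y = iter_partial js f y.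
  by apply: near_eq => // y Uy; rewrite Hg.
split.
  apply: (@cvg_trans _ (g @ x)); first exact: (near_eq_cvg ngf).
  by rewrite [iter_partial js f x]Hg//; exact: cC.
move=> j; have [h _ Hh] := dC g j Cg.
by apply: near_eq_derivable ngf _; have [] := Hh x Ux.
Unshelve. all: by end_near. Qed.

Section ball_power_expr.
Context (R : realType) (n : nat) (x0 : 'rV[R]_n) (a0 : R).

(** A class closed under partial differentiation that contains the solution near B_1. The exponent
    is an arbitrary real, since differentiation lowers it; [a0 <= a] keeps the base positive where
    |x - x0|^2 < a0. *)
Inductive ball_power_expr : ('rV[R]_n -> R) -> Prop :=
| expr_cst c : ball_power_expr (fun=> c)
| expr_coord i : ball_power_expr (fun x => x 0 i)
| expr_power a p : a0 <= a ->
    ball_power_expr (fun x => (a - dot (x - x0) (x - x0)) `^ p)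
| expr_add f g : ball_power_expr f -> ball_power_expr g ->
    ball_power_expr (fun x => f x + g x)
| expr_mul f g : ball_power_expr f -> ball_power_expr g ->
    ball_power_expr (fun x => f x * g x).

Lemma ball_power_expr_sum (I : Type) (r : seq I) (f : I -> 'rV[R]_n -> R) :
  (forall i, ball_power_expr (f i)) -> ball_power_expr (fun x => \sum_(i <- r) f i x).
Proof.
move=> H; elim: r => [|i r IH].
  by under eq_fun do rewrite big_nil; exact: expr_cst.
by under eq_fun do rewrite big_cons; exact: expr_add.
Qed.

Lemma dot_sub_continuous : continuous (fun x : 'rV[R]_n => dot (x - x0) (x - x0)).
Proof.
move=> x; apply: (@cvg_sumr _ _ _ (nbhs x)) => i.
have c : (y - x0) 0 i @[y --> x] --> (x - x0) 0 i.
  have -> : (fun y : 'rV[R]_n => (y - x0) 0 i) = (fun y => y 0 i - x0 0 i).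
    by apply/funext => y; rewrite !mxE.
  have -> : (x - x0) 0 i = x 0 i - x0 0 i by rewrite !mxE.
  exact: (cvgB (@coord_continuous R 1 n 0 i x) (cvg_cst (x0 0 i))).
exact: cvgM.
Qed.

Lemma ball_power_expr_continuous f x : ball_power_expr f ->
  dot (x - x0) (x - x0) < a0 -> {for x, continuous f}.
Proof.
move=> Cf xa; elim: Cf => {f} [c|i|a p aa|f g _ cf _ cg|f g _ cf _ cg].
- exact: cst_continuous.
- exact: (@coord_continuous R 1 n 0 i x).
- have ca : {for x, continuous (fun x : 'rV[R]_n => a - dot (x - x0) (x - x0))}.
    exact: (cvgB (cvg_cst a) (@dot_sub_continuous x)).
  have pa : 0 < a - dot (x - x0) (x - x0) by rewrite subr_gt0 (lt_le_trans xa).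
  have cp : {for (a - dot (x - x0) (x - x0)), continuous (fun y : R => y `^ p)}.
    apply/differentiable_continuous/derivable1_diffP.
    by apply: derivable_powR; rewrite in_itv/= pa.
  exact: (continuous_comp ca cp).
- exact: (cvgD cf cg).
- exact: (cvgM cf cg).
Qed.

Lemma ball_power_expr_derive f (j : 'I_n) : ball_power_expr f ->
  exists2 g, ball_power_expr g & forall x, dot (x - x0) (x - x0) < a0 ->
    is_derive x (delta_mx 0 j) f (g x).
Proof.
elim => {f} [c|i|a p aa|f1 f2 E1 [g1 Eg1 d1] E2 [g2 Eg2 d2]|f1 f2 E1 [g1 Eg1 d1] E2 [g2 Eg2 d2]].
- by exists (fun=> 0) => [|x _]; [exact: expr_cst|exact: is_derive_cst].
- exists (fun=> (i == j)%:R) => [|x _]; first exact: expr_cst.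
  apply: is_derive_lineP.
  have -> : (fun h : R => (h *: delta_mx 0 j + x : 'rV[R]_n) 0 i) =
      (fun h => h * (i == j)%:R + x 0 i).
    by apply/funext => h; rewrite !mxE eqxx.
  by apply: is_derive_eq; rewrite scaler0 add0r addr0 [LHS]mulr1.
- exists (fun x : 'rV[R]_n => (- 2 * p) * ((x 0 j + - x0 0 j) * (a - dot (x - x0) (x - x0)) `^ (p - 1))).
    apply: expr_mul; first exact: expr_cst.
    apply: expr_mul; last exact: expr_power.
    by apply: expr_add; [exact: expr_coord|exact: expr_cst].
  move=> x xa; apply: is_derive_lineP.
  set v := delta_mx 0 j.
  have vv : dot v v = 1.
    rewrite /dot (bigD1 j)//= !mxE !eqxx mulr1 big1 ?addr0// => i ij.
    by rewrite !mxE eqxx (negbTE ij) mulr0.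
  have xv : dot (x - x0) v = x 0 j - x0 0 j.
    rewrite /dot (bigD1 j)//= !mxE !eqxx mulr1 big1 ?addr0// => i ij.
    by rewrite !mxE eqxx (negbTE ij) mulr0.
  (* The base of the power restricted to the line through x in the j-th coordinate direction. *)
  pose q h := a - (dot (x - x0) (x - x0) + 2 * h * (x 0 j - x0 0 j) + h ^+ 2).
  have -> : (fun h : R => (a - dot (h *: v + x - x0) (h *: v + x - x0)) `^ p) =
            (fun h => q h `^ p).
    apply/funext => h; congr (_ `^ _); rewrite /q.
    rewrite (_ : h *: v + x - x0 = (x - x0) + h *: v); last by rewrite -addrA addrC.
    by rewrite sqr_normD_dot dotZr dotZ vv xv; ring.
  have q0 : 0 < q 0.
    by rewrite /q !(mulr0, mul0r, expr0n, addr0)/= subr_gt0 (lt_le_trans xa).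
  have dq : is_derive (0 : R) (1 : R) q (- (2 * (x 0 j - x0 0 j))).
    by apply: is_derive_eq; rewrite /GRing.scale/=; ring.
  have := @is_derive1_comp R (fun y => y `^ p) q 0 _ _ (is_derive1_powR p q0) dq.
  rewrite /comp => dd; apply: (is_derive_eq dd).
  rewrite /q !(mulr0, mul0r, expr0n, addr0)/=; ring.
- exists (fun x : 'rV[R]_n => g1 x + g2 x) => [|x xa]; first exact: expr_add.
  by have := d1 x xa; have := d2 x xa => h2 h1; exact: is_deriveD.
- exists (fun x : 'rV[R]_n => f1 x * g2 x + f2 x * g1 x) => [|x xa].
    by apply: expr_add; exact: expr_mul.
  by have := d1 x xa; have := d2 x xa => h2 h1; exact: is_deriveM.
Qed.
End ball_power_expr.

(** * Limits at a boundary point *)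

Lemma cvg_limf_esup (R : realType) (X : topologicalType) (F : set_system X)
    (FF : ProperFilter F) (f : X -> R) (l : R) :
  f x @[x --> F] --> l -> limf_esup (fun x => (f x)%:E) F = l%:E.
Proof.
move=> fl; rewrite limf_esupE; apply/eqP; rewrite eq_le; apply/andP; split.
  apply/lee_addgt0Pr => e e0; rewrite -EFinD.
  apply: ge_ereal_inf.
  exists (ereal_sup ((fun x => (f x)%:E) @` [set x | `|l - f x| < e])).
    exists [set x | `|l - f x| < e] => //.
    by move/cvgrPdist_lt : fl => /(_ e e0).
  apply: ge_ereal_sup => _ [x /= lx <-]; rewrite lee_fin.
  by move: lx; rewrite ltr_norml => /andP[]; lra.
apply: le_ereal_inf_tmp => _ [V FV <-].
apply/lee_subgt0Pr => e e0; rewrite -EFinB.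
have FW : F [set x | `|l - f x| < e] by move/cvgrPdist_lt : fl => /(_ e e0).
(* Properness of [F] supplies a point of every [V] at which [f] is close to [l], so no supremum over
   [V] falls below [l]. *)
have [x [Vx lx]] := filter_ex (filterI FV FW).
apply: (@le_trans _ _ (f x)%:E); last by apply: ereal_sup_ubound; exists x.
by rewrite lee_fin; move: lx; rewrite /= ltr_norml => /andP[]; lra.
Qed.

Section boundary_point.
Context (R : realType) (n : nat) (x0 : 'rV[R]_n).
Hypothesis (hx0 : enorm x0 = 1).

Lemma dot_unit : dot x0 x0 = 1.
Proof. by rewrite -sqr_enorm hx0 expr1n. Qed.

Lemma unit_neq0 : x0 != 0.
Proof.
apply/eqP => x00; have := dot_unit; rewrite x00 /dot.
rewrite big1 => [/eqP|i _]; first by rewrite eq_sym oner_eq0.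
by rewrite mxE mul0r.
Qed.

Lemma dot_eq0 (y : 'rV[R]_n) : dot y y = 0 -> y = 0.
Proof.
move=> /eqP; rewrite psumr_eq0 => [/allP h|i _]; last by rewrite -expr2 sqr_ge0.
apply/rowP => i; rewrite mxE; apply/eqP.
by have := h i (mem_index_enum _); rewrite -expr2 sqrf_eq0.
Qed.

(** Points on the inner normal witness that the punctured neighbourhoods of [x0], and their
    intersections with the cones, are nonempty. *)
Lemma near_radial (V : set 'rV[R]_n) : nbhs x0 V ->
  exists2 r : R, 0 < r < 1 & V ((1 - r) *: x0).
Proof.
move=> Vx.
have c : (1 - r) *: x0 @[r --> (0 : R)^'+] --> x0.
  apply: cvg_at_right_filter.
  have h : (1 - r) *: x0 @[r --> (0 : R)] --> (1 - 0) *: x0.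
    by apply: cvgZ; [apply: cvgB; [exact: cvg_cst|exact: cvg_id]|exact: cvg_cst].
  by move: h; rewrite subr0 scale1r.
have h := c V Vx.
have [r [Vr [r0 r1]]] : exists r : R, V ((1 - r) *: x0) /\ 0 < r /\ r < 1.
  apply: (@filter_ex _ ((0 : R)^'+)).
  near=> r; split; first by near: r.
  by split; near: r; [exact: nbhs_right_gt|exact: nbhs_right_lt].
by exists r => //; rewrite r0.
Unshelve. all: by end_near. Qed.

Lemma radial_sub (r : R) : (1 - r) *: x0 - x0 = - r *: x0.
Proof. by rewrite scalerBl scale1r addrAC subrr add0r scaleNr. Qed.

Lemma radial_in_cone (beta r : R) : 0 < beta < pi / 2 -> 0 < r < 1 ->
  (eball 0 1 `&` inner_cone x0 beta) ((1 - r) *: x0).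
Proof.
move=> /andP[b0 b1] /andP[r0 r1]; split.
  by rewrite /eball/= subr0 enormZ hx0 mulr1 ger0_norm; lra.
rewrite /inner_cone/= /angle radial_sub.
have -> : - x0 = -1 *: x0 by rewrite scaleN1r.
rewrite !enormZ hx0 !mulr1 !normrN normr1 mulr1 (gtr0_norm r0).
have -> : dot (- r *: x0) (-1 *: x0) = r.
  by rewrite dotZr /dot; under eq_bigr do rewrite mxE -mulrA; rewrite -mulr_sumr -/(dot x0 x0) dot_unit; ring.
by rewrite divff ?gt_eqF// acos1 subr_gt0.
Qed.

Lemma sqr_dist_eball (x : 'rV[R]_n) : eball 0 1 x -> dot (x - x0) (x - x0) < 4.
Proof.
rewrite /eball/= subr0 => x1.
have xx : dot x x < 1.
  by rewrite -sqr_enorm expr2 mulr_ilt1 ?enorm_ge0.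
have := dot_le x (- x0); rewrite dotNN dot_unit ler_norml => /andP[_ h].
by rewrite sqr_normD_dot dotNN dot_unit; lra.
Qed.

(** This carries one-sided limits of the profile in t = |x - x0|^2 over to limits at [x0]. *)
Lemma cvg_sqr_dist : dot (x - x0) (x - x0) @[x --> x0^'] --> (0 : R)^'+.
Proof.
move=> P P0.
have h : \forall t \near (0 : R), 0 < t -> P t by exact: P0.
have c := @dot_sub_continuous R n x0 x0.
have d0 : dot (x0 - x0) (x0 - x0) = 0.
  by rewrite subrr /dot big1// => i _; rewrite mxE mul0r.
rewrite /continuous_at d0 in c.
have h' : \forall x \near x0, 0 < dot (x - x0) (x - x0) ->
  P (dot (x - x0) (x - x0)) by exact: c _ h.
apply: filterS h' => x H xx0.
apply: H; rewrite lt_neqAle dot_ge0 andbT eq_sym.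
by apply/eqP => /dot_eq0/eqP; rewrite subr_eq0 (negbTE xx0).
Qed.

Lemma open_unit_ball : open (eball (0 : 'rV[R]_n) 1).
Proof.
have -> : eball (0 : 'rV[R]_n) 1 = (fun x => dot (x - 0) (x - 0)) @^-1` [set t | t < 1].
  apply/seteqP; split=> x; rewrite /eball/= -sqr_enorm.
    by move=> h; rewrite expr2 mulr_ilt1 ?enorm_ge0.
  by rewrite -[X in _ < X](expr1n R 2) ltr_pXn2r ?nnegrE ?enorm_ge0.
apply: open_comp; last exact: open_lt.
by move=> x _; exact: dot_sub_continuous.
Qed.

Lemma dnbhs_boundary_proper : ProperFilter x0^'.
Proof.
apply: Build_ProperFilter_ex => P; rewrite /dnbhs /within /= => h.
have [r /andP[r0 r1] Pr] := near_radial h; exists ((1 - r) *: x0).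
apply: Pr; rewrite -subr_eq0 radial_sub scaler_eq0 negb_or oppr_eq0 gt_eqF//=.
exact: unit_neq0.
Qed.

Lemma cone_proper (beta : R) : 0 < beta < pi / 2 ->
  ProperFilter (within (eball 0 1 `&` inner_cone x0 beta) (nbhs x0)).
Proof.
move=> hb; apply: Build_ProperFilter_ex => P; rewrite /within /= => h.
have [r hr Pr] := near_radial h; exists ((1 - r) *: x0).
by apply: Pr; exact: radial_in_cone.
Qed.

End boundary_point.

(** * The normalized solution and its properties *)

Section flat_solution.
Context (R : realType) (n m : nat) (s : R) (x0 : 'rV[R]_n) (L : R).
Hypotheses (s0 : 0 < s) (s1 : s < 1).

Definition flat_solution : 'rV[R]_n -> R :=
  ball_combination s (fun i : 'I_(size (flat_poly s m)) => flat_radius R i) x0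
    (fun i => L^-1 * (flat_poly s m)`_i).

Lemma flat_coef_sum0 :
  \sum_(i < size (flat_poly s m)) L^-1 * (flat_poly s m)`_i = 0.
Proof.
have E : (flat_poly s m).[1] = \sum_(i < size (flat_poly s m)) (flat_poly s m)`_i.
  by rewrite horner_coef; apply: eq_bigr => i _; rewrite expr1n mulr1.
by rewrite -mulr_sumr -E flat_poly1 mulr0.
Qed.

Lemma flat_solutionE y : dot (y - x0) (y - x0) < 5 ->
  flat_solution y = L^-1 * flat_sum s m 0 (dot (y - x0) (y - x0)).
Proof.
move=> y5; rewrite /flat_solution /ball_combination mulr_sumr.
apply: eq_bigr => i _; rewrite mulrA subr0 pospowE// subr_ge0.
by apply: ltW; apply: lt_le_trans y5 (flat_radius_ge5 _ i).
Qed.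

Lemma flat_solution_continuous : continuous flat_solution.
Proof.
move=> y; apply: (@cvg_sumr _ _ _ (nbhs y)) => i.
have c : {for y, continuous (fun y : 'rV[R]_n => flat_radius R i - dot (y - x0) (y - x0))}.
  exact: (cvgB (cvg_cst (flat_radius R i)) (@dot_sub_continuous R n x0 y)).
apply: cvgM; first exact: cvg_cst.
by apply: (continuous_comp c); exact: pospow_continuous.
Qed.

Lemma flat_solution_compactly_supported : compactly_supported flat_solution.
Proof.
(* The indices in the sum stay below the size, so this radius exceeds all those used; beyond it
   every summand vanishes, and the support lies in a closed cube. *)
pose r := Num.sqrt (flat_radius R (size (flat_poly s m))).
pose I (i : 'I_n) : set R := `[x0 0 i - r, x0 0 i + r]%classic.
have cI : compact [set y : 'rV[R]_n | forall i, I i (y ord0 i)].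
  by apply: rV_compact => i; exact: segment_compact.
apply: (subclosed_compact _ cI); first exact: closed_closure.
rewrite [X in _ `<=` X](iffLR (closure_id _)); last first.
  exact: compact_closed (@norm_hausdorff _ _) cI.
apply: closure_subset => y /= uy i.
have yr : dot (y - x0) (y - x0) <= flat_radius R (size (flat_poly s m)).
  rewrite leNgt; apply: contraNN uy => yr.
  rewrite /flat_solution /ball_combination big1// => j _.
  rewrite pospow_le0 ?mulr0// subr_le0; apply: ltW; apply: le_lt_trans yr.
  by rewrite /flat_radius ler_wpM2l// ler_weXn2l ?ler1n// ltnW.
have : `|(y - x0) 0 i| <= r.
  rewrite -sqrtr_sqr ler_wsqrtr//; apply: le_trans yr.
  rewrite /dot (bigD1 i)//= -expr2 lerDl.
  by apply: sumr_ge0 => j _; rewrite -expr2 sqr_ge0.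
rewrite /I/= in_itv/= !mxE ler_norml => /andP[h1 h2].
by apply/andP; split; lra.
Qed.

Lemma flat_solution_smooth : enorm x0 = 1 -> smooth_on (eball 0 1) flat_solution.
Proof.
move=> hx0.
pose g (y : 'rV[R]_n) := \sum_(i < size (flat_poly s m))
  L^-1 * (flat_poly s m)`_i * (flat_radius R i - dot (y - x0) (y - x0)) `^ s.
apply: (@smooth_on_closed_class R n (eball 0 1) (ball_power_expr x0 5) _ _ _ _ g).
- exact: open_unit_ball.
- move=> f y Cf /(sqr_dist_eball hx0) y4.
  apply: (ball_power_expr_continuous Cf); lra.
- move=> f j /(ball_power_expr_derive j)[h Ch Hh]; exists h => // y.
  by move=> /(sqr_dist_eball hx0) y4; apply: Hh; lra.
- have H (i : 'I_(size (flat_poly s m))) : ball_power_expr x0 5 (fun y =>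
     L^-1 * (flat_poly s m)`_i * (flat_radius R i - dot (y - x0) (y - x0)) `^ s).
    apply: expr_mul; first exact: expr_cst.
    by apply: expr_power; exact: flat_radius_ge5.
  exact: (ball_power_expr_sum _ H).
- move=> y /(sqr_dist_eball hx0) y4; rewrite /flat_solution /ball_combination.
  apply: eq_bigr => i _; rewrite pospowE// subr_ge0.
  by have := flat_radius_ge5 R i; lra.
Qed.

Lemma flat_solution_frac_laplacian x : enorm x0 = 1 -> eball 0 1 x ->
  is_frac_laplacian s flat_solution x 0.
Proof.
move=> hx0 /(sqr_dist_eball hx0) x4.
apply: ball_combination_frac_laplacian => //; last exact: flat_coef_sum0.
by move=> i; have := flat_radius_ge5 R i; lra.
Qed.

Hypotheses (m0 : (0 < m)%N) (L0 : L != 0).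

Lemma sqr_dist0 : dot (x0 - x0) (x0 - x0) = 0.
Proof. by rewrite subrr /dot big1// => i _; rewrite mxE mul0r. Qed.

Lemma flat_solution0 : flat_solution x0 = 0.
Proof.
by rewrite flat_solutionE sqr_dist0// flat_sum0 flat_poly_root// !mulr0.
Qed.

Hypothesis HL : flat_sum s m 0 t / t ^+ m @[t --> 0^'+] --> L.

Lemma flat_profile : L^-1 * flat_sum s m 0 t / t ^+ m @[t --> 0^'+] --> (1 : R).
Proof.
have -> : (fun t => L^-1 * flat_sum s m 0 t / t ^+ m) =
   (fun t => L^-1 * (flat_sum s m 0 t / t ^+ m)).
  by apply/funext => t; rewrite mulrA.
by rewrite -[X in _ --> X](mulVf L0); apply: cvgM; [exact: cvg_cst|exact: HL].
Qed.

Lemma flat_solution_cvg : enorm x0 = 1 ->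
  flat_solution x / enorm (x - x0) ^+ (2 * m) @[x --> x0^'] --> (1 : R).
Proof.
move=> hx0; have c := cvg_comp _ _ (@cvg_sqr_dist R n x0) flat_profile.
apply: cvg_trans c; apply: near_eq_cvg.
have h : \forall y \near x0, dot (y - x0) (y - x0) < 5.
  have c := @dot_sub_continuous R n x0 x0.
  rewrite /continuous_at sqr_dist0 in c.
  move/cvgrPdist_lt : c => /(_ 5 ltac:(by [])); apply: filterS => y.
  by rewrite sub0r normrN; apply: le_lt_trans; exact: ler_norm.
have h' : \forall y \near x0^', dot (y - x0) (y - x0) < 5.
  by apply: filterS h.
near=> y; rewrite /= exprM sqr_enorm flat_solutionE//; near: y.
exact: h'.
Unshelve. all: by end_near. Qed.

Lemma flat_solution_gt0 : exists2 rho : R, 0 < rho < 1 &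
  forall x, eball x0 rho x -> x != x0 -> 0 < flat_solution x.
Proof.
have h2 : (0 : R) < 2^-1 by rewrite invr_gt0.
(* For 0 < t < e the normalized quotient is within 1/2 of its limit 1, hence positive. *)
have /cvgrPdist_lt/(_ _ h2)[e /= e0 He] := flat_profile.
(* The profile is evaluated at t = N^2, and N < 1/2 gives N^2 <= N < e. *)
exists (Num.min 2^-1 e).
  by rewrite lt_min h2 e0 gt_min; apply/orP; left; lra.
move=> x; rewrite /eball/= lt_min => /andP[x1 x2] xx0.
set N := enorm (x - x0) in x1 x2.
have N0 : 0 <= N by exact: enorm_ge0.
have dN : dot (x - x0) (x - x0) = N ^+ 2 by rewrite sqr_enorm.
have d0 : 0 < dot (x - x0) (x - x0).
  rewrite lt_neqAle dot_ge0 andbT eq_sym.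
  by apply/eqP => /dot_eq0/eqP; rewrite subr_eq0 (negbTE xx0).
have N2 : N ^+ 2 <= N by rewrite expr2 ler_piMl//; lra.
rewrite flat_solutionE; last by rewrite dN; lra.
have := He (dot (x - x0) (x - x0)); rewrite /ball_/= sub0r normrN gtr0_norm// dN.
move=> /(_ (le_lt_trans N2 x2)); rewrite -dN => /(_ d0).
set v := L^-1 * _; rewrite ltr_norml => /andP[_ h].
have : 0 < v / dot (x - x0) (x - x0) ^+ m by lra.
by rewrite pmulr_lgt0// invr_gt0 exprn_gt0.
Qed.

Lemma flat_solution_cvg0 (p : R) : enorm x0 = 1 -> p < (2 * m)%:R ->
  flat_solution x / enorm (x - x0) `^ p @[x --> x0^'] --> (0 : R).
Proof.
move=> hx0 pm; have c1 := flat_solution_cvg hx0.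
(* Factor u / |x - x0|^p as u / |x - x0|^(2m), which tends to 1, times |x - x0|^2 to the power (2m -
   p) / 2, which tends to 0. *)
have q0 : 0 < 2^-1 * ((2 * m)%:R - p) by rewrite mulr_gt0 ?invr_gt0// subr_gt0.
have c2 := cvg_comp _ _ (@cvg_sqr_dist R n x0) (powR_cvg0 q0).
have c3 := cvgM c1 c2; rewrite mulr0 in c3.
apply: (@cvg_trans _ ((fun y : 'rV[R]_n => flat_solution y / enorm (y - x0) ^+ (2 * m) *
  dot (y - x0) (y - x0) `^ (2^-1 * ((2 * m)%:R - p))) @ x0^')); last exact: c3.
apply: near_eq_cvg.
have h : \forall y \near x0^', y != x0 by exact: nbhs_dnbhs_neq.
near=> y.
have y0 : y != x0 by near: y.
have N0 : 0 < enorm (y - x0).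
  rewrite lt_neqAle enorm_ge0 andbT eq_sym.
  apply/eqP => N0; move/eqP: y0; apply; apply/eqP; rewrite -subr_eq0; apply/eqP.
  by apply: dot_eq0; rewrite -sqr_enorm N0 expr0n.
rewrite /= powRrM powR12_sqrt ?dot_ge0// -/(enorm (y - x0)).
rewrite powRB ?(gt_eqF N0) ?implybT// powR_mulrn ?(ltW N0)//.
by rewrite mulrA divfK// expf_neq0// gt_eqF.
Unshelve. all: by end_near. Qed.

End flat_solution.

Unset Implicit Arguments.

Theorem theorem1p11 (R : realType) (n : nat) (hn : (0 < n)%N)
    (s : R) (hs0 : 0 < s) (hs1 : s < 1)
    (x0 : 'rV[R]_n) (hx0 : enorm x0 = 1)
    (k : nat) (hk2 : (2 <= k)%N) (hk : ~~ odd k) :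
  exists (rho : R) (u : 'rV[R]_n -> R),
    [/\ 0 < rho < 1,
        compactly_supported u,
        continuous u,
        smooth_on (eball 0 1) u
      & u x0 = 0] /\
    [/\ (forall x, eball 0 1 x -> is_frac_laplacian s u x 0),
        (forall x, eball x0 rho x -> x != x0 -> 0 < u x),
        limf_esup (fun x => (u x / enorm (x - x0) ^+ k)%:E) x0^' = 1%E
      & ~ (forall beta : R, 0 < beta < pi / 2 ->
            (0 < limf_einf (fun x => (u x / enorm (x - x0) `^ s)%:E)
                   (within (eball 0%R 1%R `&` inner_cone x0 beta)
                           (nbhs x0)))%E)].
Proof.
pose m := k./2.
have kE : k = (2 * m)%N by rewrite mul2n -[LHS]odd_double_half (negbTE hk).
have m0 : (0 < m)%N by rewrite -(ltn_pmul2l (isT : 0 < 2)%N) -kE muln0; lia.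
have [L L0] := flat_sum_order hs0 hs1 (leqnn m); rewrite subnn => HL.
have [rho rho01 pos] := flat_solution_gt0 x0 L0 HL.
have cvgk := flat_solution_cvg L0 HL hx0.
exists rho, (flat_solution m s x0 L); split; split => //.
- exact: flat_solution_compactly_supported.
- exact: flat_solution_continuous.
- exact: flat_solution_smooth.
- exact: flat_solution0.
- by move=> x x1; exact: flat_solution_frac_laplacian.
- rewrite kE; have P := dnbhs_boundary_proper hx0.
  exact: cvg_limf_esup.
have pi0 := @pi_gt0 R.
(* The claim fails already for the single value beta = pi / 4. *)
have hb : 0 < (pi : R) / 4 < pi / 2.
  by apply/andP; split; lra.
move=> /(_ _ hb).
set F := within _ _.
have PF : ProperFilter F by exact: cone_proper.
(* Vanishing to order k > s makes the quotient by |x - x0|^s tend to 0 along the cone, so its lower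
   limit is 0. *)
have sk : s < (2 * m)%:R by apply: (lt_le_trans hs1); rewrite ler1n muln_gt0.
have c : flat_solution m s x0 L x / enorm (x - x0) `^ s @[x --> F] --> (0 : R).
  apply: cvg_trans (flat_solution_cvg0 L0 HL hx0 sk).
  (* The cone filter refines the punctured one: [x0] has norm 1 and so lies outside the open
     ball. *)
  have FG : F --> x0^'.
    move=> P hP; have {}hP : \forall y \near x0, y != x0 -> P y by exact: hP.
    suff : \forall y \near x0, (eball 0 1 `&` inner_cone x0 (pi / 4)) y -> P y by [].
    near=> y; move=> [y1 _]; have yP : y != x0 -> P y by near: y.
    by apply: yP; apply/eqP => yx0; move: y1; rewrite yx0 /eball/= subr0 hx0 ltxx.
  exact: (cvg_app _ FG).
have cN : - (flat_solution m s x0 L x / enorm (x - x0) `^ s) @[x --> F] --> (0 : R).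
  by rewrite -[X in _ --> X]oppr0; exact: cvgN.
have E : limf_esup (fun x => (- (flat_solution m s x0 L x / enorm (x - x0) `^ s))%:E) F = 0%E.
  exact: cvg_limf_esup.
rewrite /limf_einf.
have -> : (\- (fun x => (flat_solution m s x0 L x / enorm (x - x0) `^ s)%:E))%E =
    (fun x => (- (flat_solution m s x0 L x / enorm (x - x0) `^ s))%:E).
  by apply/funext => x; rewrite EFinN.
by rewrite E oppe0 ltxx.
Unshelve. all: by end_near. Qed.
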